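(* Let $\Theta:\mathbb{D}\to M_n$ be a purely contractive analytic function and $\zeta\in\mathbb{T}$. The following are equivalent: (1) $\Theta$ has a Carathéodory angular derivative (CAD) at $\zeta$. (2) $\Theta$ has a non-tangential limit $\Theta(\zeta)$ at $\zeta$ and $c_\zeta:=\liminf_{z\to\zeta\text{ n.t.}}\left\|\dfrac{\mathbf 1-\Theta(z)\Theta(\zeta)^*}{1-|z|^2}\right\|<\infty$. (3) There is a $U\in\mathcal{U}(n)$ such that the function $z\mapsto\frac{\Theta(z)-U}{z-\zeta}\vec x$ belongs to $K^2_\Theta$ for all $\vec x\in\mathbb{C}^n$. (4) Every element of $K^2_\Theta$ has a non-tangential limit at $\zeta$. If these conditions hold, then for every $\vec x\in\mathbb{C}^n$ the function $\delta_\zeta^{\vec x}$ belongs to $K^2_\Theta$, $\langle f,\delta_\zeta^{\vec x}\rangle_\Theta=(f(\zeta),\vec x)$ for all $f\in K^2_\Theta$, and $\delta_\zeta^{\vec x}$ is the norm limit of $\delta_z^{\vec x}$ as $z\to\zeta$ non-tangentially. Moreover $\Theta'(\zeta)=\overline\zeta A\Theta(\zeta)$ where $A>0$ (so $\Theta'(\zeta)$ is invertible), and $\frac{\mathbf 1-\Theta(z)\Theta(z)^*}{1-|z|^2}$ converges to $A$ as $z\to\zeta$ non-tangentially.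
   Context: $\mathbb{D}$ is the open unit disc, $\mathbb{T}$ the unit circle, $M_n$ the complex $n\times n$ matrices, $\mathbf 1$ the identity, $\mathcal{U}(n)$ the unitary matrices, $(\cdot,\cdot)$ the inner product of $\mathbb{C}^n$; ''n.t.'' means non-tangentially from within $\mathbb{D}$. Purely contractive: $\|\Theta(z)\|\le1$ on $\mathbb{D}$ and $\|\Theta(0)\|<1$. $\Theta$ has a Carathéodory angular derivative at $\zeta\in\mathbb{T}$ if $\Theta$ has a non-tangential limit $\Theta(\zeta)$ at $\zeta$ with $|\Theta(\zeta)|=(\Theta(\zeta)^*\Theta(\zeta))^{1/2}=\mathbf 1$ (i.e. $\Theta(\zeta)$ unitary), and $\Theta'$ has a non-tangential limit at $\zeta$, denoted $\Theta'(\zeta)$. $K^2_\Theta$ is the de Branges–Rovnyak space: the range of $(\mathbf 1-T_\Theta T_\Theta^* )^{1/2}$ on the $\mathbb{C}^n$-valued Hardy space $H^2_n(\mathbb{D})$ ($T_\Theta$ = multiplication by $\Theta$), with the inner product $\langle\cdot,\cdot\rangle_\Theta$ making this operator a co-isometry onto its range; equivalently, the reproducing kernel Hilbert space with matrix kernel $\Delta_w(z)=\frac{\mathbf 1-\Theta(z)\Theta(w)^*}{1-z\overline w}$. $\delta_w^{\vec x}(z)=\Delta_w(z)\vec x$, for $w\in\mathbb{D}$, or for $w=\zeta\in\mathbb{T}$ using the non-tangential limit $\Theta(\zeta)$; $f(\zeta)$ denotes the non-tangential limit of $f$ at $\zeta$. *)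

(* Defs.v *)
From HB Require Import structures.
From mathcomp Require Import all_boot all_order all_algebra.
From mathcomp Require Import complex.
From mathcomp Require Import all_classical all_reals all_analysis.

Set Implicit Arguments.
Unset Strict Implicit.
Unset Printing Implicit Defensive.

Import Order.TTheory GRing.Theory Num.Def Num.Theory.
Import numFieldNormedType.Exports.

Local Open Scope classical_set_scope.
Local Open Scope ring_scope.
Local Open Scope complex_scope.
Local Open Scope sesquilinear_scope.

(* The library attaches the norm topology to an abstract numClosedFieldType;
   these copies make it available on R[i] itself. *)
#[non_forgetful_inheritance]
HB.instance Definition _ (R : rcfType) :=
  PseudoPointedMetric.copy R[i] (R[i] : numClosedFieldType).
#[non_forgetful_inheritance]
HB.instance Definition _ (R : rcfType) :=
  NormedModule.copy R[i] (R[i] : numClosedFieldType).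

Definition disc (R : realType) := {z : R[i] | `|z| < 1}.

HB.instance Definition _ (R : realType) :=
  Topological.copy (disc R) (initial_topology (fun z : disc R => sval z)).

Section euclidean.
Variables (R : realType) (n : nat).

(* Linear in the first argument. *)
Definition cdot (x y : 'cV[R[i]]_n) : R[i] := (y ^t* *m x) 0 0.

Definition cnorm (x : 'cV[R[i]]_n) : R := Num.sqrt (complex.Re (cdot x x)).

Definition opnorm (A : 'M[R[i]]_n) : R :=
  sup [set cnorm (A *m x) | x in [set x | cnorm x <= 1]].

(* In R[i], [0 < z] means that z is real and positive, so A is Hermitian. *)
Definition posdefmx (A : 'M[R[i]]_n) : Prop :=
  forall x : 'cV[R[i]]_n, x != 0 -> 0 < cdot (A *m x) x.

End euclidean.

Section nontangential.
Variable R : realType.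

(* [f @ nt_nbhs zeta --> l] says that f(z) tends to l as z tends to zeta within
   each of the regions |z - zeta| < M (1 - |z|).  The limit inferior along this
   filter is the infimum over M of the limits inferior within these regions. *)
Definition nt_nbhs (zeta : R[i]) : set_system (disc R) :=
  [set A | forall M : R, 1 < M -> exists2 e : R, 0 < e &
    forall z : disc R, `|sval z - zeta| < e%:C ->
      `|sval z - zeta| < M%:C * (1 - `|sval z|) -> A z].

Definition has_ntlim (V : ptopologicalType) (f : disc R -> V) (zeta : R[i]) :=
  cvg (f @ nt_nbhs zeta).

Definition ntlim (V : ptopologicalType) (f : disc R -> V) (zeta : R[i]) : V :=
  lim (f @ nt_nbhs zeta).

End nontangential.

Section contractive.
Variables (R : realType) (n : nat) (Theta : R[i] -> 'M[R[i]]_n).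

(* Only the values of Theta on the disc matter in what follows. *)
Definition analytic_on_disc : Prop :=
  forall z : disc R, derivable Theta (sval z) 1.

Definition purely_contractive : Prop :=
  (forall z : disc R, opnorm (Theta (sval z)) <= 1) /\ opnorm (Theta 0) < 1.

Definition on_disc : disc R -> 'M[R[i]]_n := fun z => Theta (sval z).

Definition ntval (zeta : R[i]) : 'M[R[i]]_n := ntlim on_disc zeta.

Definition deriv_on_disc : disc R -> 'M[R[i]]_n :=
  fun z => derive1 Theta (sval z).

Definition has_CAD (zeta : R[i]) : Prop :=
  [/\ has_ntlim on_disc zeta, ntval zeta \is unitarymx
    & has_ntlim deriv_on_disc zeta].

(* The function Delta_w(z), where W stands for Theta(w); W is a separate
   argument so that w may also be a boundary point. *)
Definition dBR_kernel (w : R[i]) (W : 'M[R[i]]_n) (z : disc R) : 'M[R[i]]_n :=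
  (1 - sval z * w^*)^-1 *: (1%:M - Theta (sval z) *m W ^t*).

Definition delta (w : disc R) (x : 'cV[R[i]]_n) : disc R -> 'cV[R[i]]_n :=
  fun z => dBR_kernel (sval w) (Theta (sval w)) z *m x.

Definition delta_bdry (zeta : R[i]) (x : 'cV[R[i]]_n) :
    disc R -> 'cV[R[i]]_n :=
  fun z => dBR_kernel zeta (ntval zeta) z *m x.

End contractive.

Section rkhs.
Variables (R : realType) (n : nat) (T : Type).
Implicit Types (K : set (T -> 'cV[R[i]]_n))
  (ip : (T -> 'cV[R[i]]_n) -> (T -> 'cV[R[i]]_n) -> R[i]).

Definition hnorm ip (f : T -> 'cV[R[i]]_n) : R :=
  Num.sqrt (complex.Re (ip f f)).

(* (K, ip) is the Hilbert space of vector-valued functions on T reproduced by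
   the kernel k, with k w z = k_w(z); k determines K, and ip on K. *)
Record is_rkhs (k : T -> T -> 'M[R[i]]_n) K ip : Prop := IsRKHS {
  rkhs0 : K 0;
  rkhs_lin : forall (a : R[i]) f g, K f -> K g -> K (a *: f + g);
  rkhs_ip_lin : forall (a : R[i]) f g h, K f -> K g -> K h ->
    ip (a *: f + g) h = a * ip f h + ip g h;
  rkhs_ip_sym : forall f g, K f -> K g -> ip g f = (ip f g)^*;
  rkhs_ip_ge0 : forall f, K f -> 0 <= ip f f;
  rkhs_ip_eq0 : forall f, K f -> ip f f = 0 -> f = 0;
  rkhs_complete : forall u : nat -> T -> 'cV[R[i]]_n,
    (forall i, K (u i)) ->
    (forall e : R, 0 < e -> exists N : nat, forall i j : nat,
       (N <= i)%N -> (N <= j)%N -> hnorm ip (u i - u j) < e) ->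
    exists2 f, K f & hnorm ip (u i - f) @[i --> \oo] --> (0 : R);
  rkhs_kernel : forall w x, K (fun z => k w z *m x);
  rkhs_reproducing : forall f w x, K f ->
    ip f (fun z => k w z *m x) = cdot (f w) x }.

End rkhs.

(* (K, ip) is the de Branges-Rovnyak space of Theta. *)
Definition is_dBR (R : realType) (n : nat) (Theta : R[i] -> 'M[R[i]]_n)
    (K : set (disc R -> 'cV[R[i]]_n))
    (ip : (disc R -> 'cV[R[i]]_n) -> (disc R -> 'cV[R[i]]_n) -> R[i]) : Prop :=
  is_rkhs (fun w => dBR_kernel Theta (sval w) (Theta (sval w))) K ip.

(* Main.v *)
Require Import Defs.
From HB Require Import structures.
From mathcomp Require Import all_boot all_order all_algebra.
From mathcomp Require Import complex.
From mathcomp Require Import all_classical all_reals all_analysis.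
From mathcomp Require Import ring lra.
Import Order.TTheory GRing.Theory Num.Def Num.Theory.
Import numFieldNormedType.Exports.
Local Open Scope classical_set_scope.
Local Open Scope ring_scope.
Local Open Scope complex_scope.
Local Open Scope sesquilinear_scope.

Set Implicit Arguments.
Unset Strict Implicit.
Unset Printing Implicit Defensive.

(* Norm-bounded families of kernel functions converge weakly as soon as they
   converge pointwise, since the kernel functions span a dense subspace.  Write
   U for Theta(zeta) and delta_zeta for the kernel function at zeta built
   from U.
   Under (2) the norms of delta_z are bounded along a sequence in a Stolz
   region, so delta_zeta is a weak limit and belongs to K, which amounts to (3).
   If delta_zeta is in K, then Cauchy-Schwarz gives
     |(Theta(z)^* - U^* ) y| <= C |z - zeta| |delta_z^y|,
   and comparison with (1 - |z|^2) |delta_z^y|^2 = |y|^2 - |Theta(z)^* y|^2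
   bounds |delta_z^y| in every Stolz region, whence (4).  Under (4) the uniform
   boundedness principle bounds |delta_z^y| again.

   The limit of Theta' is obtained without Cauchy's formula: K is contractively
   invariant under the backward shift, hence
     |delta_w^y - delta_z^y| <= |w - z| |delta_z^y| / (1 - |w|),
   which controls the increments of Theta.  The matrix A is the Gram matrix of
   delta_zeta.  Finally (1) gives (2) by the mean value theorem on the radius
   ending at zeta. *)

(** * Inner product spaces of vectors *)

(** Every estimate is drawn from one relation: [1 - z w^*] times the inner product of delta_w^x and
    delta_z^y equals (x, y) minus the inner product of [Theta(w)^* x] and [Theta(z)^* y]. The
    boundary arguments are therefore made in an abstract Hilbert space with a total family of
    vectors satisfying it, and delta_zeta is characterised by the same relation at w = zeta. Weak
    limits are taken along decreasing sequences of sets rather than of points; this fits whole Stolz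
    regions as well as the scattered points that (2) provides. Weak convergence of delta_z does not
    by itself give convergence of the norms. What forces it is that twice the real part of
    [1 - z zeta^*] equals [1 - |z|^2] plus [|z - zeta|^2], where the last term and the product of
    two differences [Theta(z)^* - U^*] are both of second order. Under (4) no boundary value of
    Theta is at hand. Bounded kernels make [Theta(w)] invertible for some w near zeta, and the
    formula for delta_w can then be solved for [Theta(z)]. *)

Section Modulus.
Variable R : realType.
Implicit Types z w : R[i].

(** The norm of [R[i]] takes its values in [R[i]]; a modulus with values in [R] keeps the estimates
    in an ordered field, within reach of [lra] and [nra]. *)
Definition cmod z : R := Num.sqrt (complex.Re z ^+ 2 + complex.Im z ^+ 2).

Lemma realcM (x y : R) : (x * y)%:C = x%:C * y%:C :> R[i].
Proof. exact: rmorphM. Qed.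

Lemma realcD (x y : R) : (x + y)%:C = x%:C + y%:C :> R[i].
Proof. exact: rmorphD. Qed.

Lemma realcB (x y : R) : (x - y)%:C = x%:C - y%:C :> R[i].
Proof. exact: rmorphB. Qed.

Lemma realc1 : 1%:C = 1 :> R[i].
Proof. by []. Qed.

Lemma realcX (x : R) k : (x ^+ k)%:C = x%:C ^+ k :> R[i].
Proof. exact: rmorphXn. Qed.

Lemma realcV (x : R) : (x^-1)%:C = x%:C^-1 :> R[i].
Proof. exact: fmorphV. Qed.

Lemma realcJ (x : R) : x%:C^*%R = x%:C :> R[i].
Proof. exact: conjc_real. Qed.

Lemma normE z : `|z| = (cmod z)%:C.
Proof. exact: normc_def. Qed.

Lemma cmod_ge0 z : 0 <= cmod z.
Proof. exact: sqrtr_ge0. Qed.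

Lemma cmod_sqr z : cmod z ^+ 2 = complex.Re z ^+ 2 + complex.Im z ^+ 2.
Proof. by rewrite sqr_sqrtr // addr_ge0 // sqr_ge0. Qed.

Lemma cmodM z w : cmod (z * w) = cmod z * cmod w.
Proof. by apply: complexI; rewrite realcM -!normE normrM. Qed.

Lemma cmodD z w : cmod (z + w) <= cmod z + cmod w.
Proof. by rewrite -lecR realcD -!normE ler_normD. Qed.

Lemma cmodN z : cmod (- z) = cmod z.
Proof. by apply: complexI; rewrite -!normE normrN. Qed.

Lemma cmodB z w : cmod (z - w) <= cmod z + cmod w.
Proof. by rewrite -(cmodN w) cmodD. Qed.

Lemma cmod_distC z w : cmod (z - w) = cmod (w - z).
Proof. by rewrite -cmodN opprB. Qed.

Lemma cmodJ z : cmod z^*%R = cmod z.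
Proof. by apply: complexI; rewrite -!normE normcJ. Qed.

Lemma cmod0 : cmod 0 = 0.
Proof. by apply: complexI; rewrite -normE normr0. Qed.

Lemma cmod1 : cmod 1 = 1.
Proof. by apply: complexI; rewrite -normE normr1. Qed.

Lemma cmod_eq0 z : (cmod z == 0) = (z == 0).
Proof. by rewrite -(inj_eq (@complexI R)) -normE normr_eq0. Qed.

Lemma cmod_gt0 z : (0 < cmod z) = (z != 0).
Proof. by rewrite lt_def cmod_ge0 andbT cmod_eq0. Qed.

Lemma cmod_real (x : R) : cmod x%:C = `|x|.
Proof. by rewrite /cmod /= expr0n addr0 sqrtr_sqr. Qed.

Lemma mulcJ z : z * z^* = (cmod z ^+ 2)%:C.
Proof. by rewrite -sqr_normc normE realcX. Qed.

Lemma Re_le_cmod z : `|complex.Re z| <= cmod z.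
Proof. by rewrite -lecR -normE normc_ge_Re. Qed.

Lemma ReD z w : complex.Re (z + w) = complex.Re z + complex.Re w.
Proof. by case: z; case: w. Qed.

Lemma ReN z : complex.Re (- z) = - complex.Re z.
Proof. by case: z. Qed.

Lemma ReJ z : complex.Re z^*%R = complex.Re z.
Proof. by case: z. Qed.

Lemma ReZ (x : R) z : complex.Re (x%:C * z) = x * complex.Re z.
Proof. by case: z => a b /=; rewrite mul0r subr0. Qed.

Lemma Re_mul_i z : complex.Re ('i * z) = - complex.Im z.
Proof. by case: z => a b /=; rewrite mul0r mul1r sub0r. Qed.

Lemma cmod_le_ReIm z : cmod z <= `|complex.Re z| + `|complex.Im z|.
Proof.
rewrite -(@ler_pXn2r _ 2) ?nnegrE ?cmod_ge0 ?addr_ge0 // cmod_sqr.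
rewrite -(real_normK (num_real (complex.Re z))) -(real_normK (num_real (complex.Im z))).
by have := normr_ge0 (complex.Re z); have := normr_ge0 (complex.Im z); nra.
Qed.

Lemma ge0_ReE z : 0 <= z -> z = (complex.Re z)%:C.
Proof. by move=> z0; rewrite RRe_real // ger0_real. Qed.

Lemma cmod_entry_le_sum (p q : nat) (A : 'I_p -> 'I_q -> R[i]) i j :
  cmod (A i j) <= \sum_i \sum_j cmod (A i j).
Proof.
rewrite (bigD1 i) //= (bigD1 j) //= -addrA lerDl addr_ge0 ?sumr_ge0 // => k _.
  exact: cmod_ge0.
by apply: sumr_ge0 => l _; exact: cmod_ge0.
Qed.

End Modulus.

(** * Semi-inner products and the Cauchy-Schwarz inequality *)

Section SemiInnerProduct.
Variables (R : realType) (V : lmodType R[i]).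

(** Relative to a subset [K], so that the same lemmas serve a space of functions and, with [setT],
    the vectors with [cdot]. *)
Record semi_inner (K : set V) (ip : V -> V -> R[i]) : Prop := SemiInner {
  semi_inner0 : K 0;
  semi_inner_lin : forall (a : R[i]) f g, K f -> K g -> K (a *: f + g);
  semi_inner_ip_lin : forall (a : R[i]) f g h, K f -> K g -> K h ->
    ip (a *: f + g) h = a * ip f h + ip g h;
  semi_inner_ip_sym : forall f g, K f -> K g -> ip g f = (ip f g)^*%R;
  semi_inner_ip_ge0 : forall f, K f -> 0 <= ip f f }.

Definition seminorm (ip : V -> V -> R[i]) (f : V) : R :=
  Num.sqrt (complex.Re (ip f f)).

Variables (K : set V) (ip : V -> V -> R[i]) (Kip : semi_inner K ip).
Local Notation sn := (seminorm ip).

Lemma KZ a f : K f -> K (a *: f).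
Proof.
by move=> Kf; have := semi_inner_lin Kip a Kf (semi_inner0 Kip); rewrite addr0.
Qed.

Lemma KD f g : K f -> K g -> K (f + g).
Proof. by move=> Kf Kg; rewrite -[f]scale1r; exact: semi_inner_lin Kip _ _ _ _ _. Qed.

Lemma KN f : K f -> K (- f).
Proof. by move=> Kf; rewrite -scaleN1r; exact: KZ. Qed.

Lemma KB f g : K f -> K g -> K (f - g).
Proof. by move=> Kf Kg; apply: KD => //; exact: KN. Qed.

Lemma ipDl f g h : K f -> K g -> K h -> ip (f + g) h = ip f h + ip g h.
Proof.
by move=> Kf Kg Kh; rewrite -{1}[f]scale1r (semi_inner_ip_lin Kip) // mul1r.
Qed.

Lemma ip0l h : K h -> ip 0 h = 0.
Proof.
move=> Kh; have K0 := semi_inner0 Kip.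
by apply: (addIr (ip 0 h)); rewrite -ipDl // !add0r.
Qed.

Lemma ipZl a f h : K f -> K h -> ip (a *: f) h = a * ip f h.
Proof.
move=> Kf Kh; have K0 := semi_inner0 Kip.
by rewrite -{1}[a *: f]addr0 (semi_inner_ip_lin Kip) // ip0l // addr0.
Qed.

Lemma ipNl f h : K f -> K h -> ip (- f) h = - ip f h.
Proof. by move=> Kf Kh; rewrite -scaleN1r ipZl // mulN1r. Qed.

Lemma ipBl f g h : K f -> K g -> K h -> ip (f - g) h = ip f h - ip g h.
Proof. by move=> Kf Kg Kh; rewrite ipDl ?ipNl //; exact: KN. Qed.

Lemma ip_sym f g : K f -> K g -> ip g f = (ip f g)^*%R.
Proof. exact: (semi_inner_ip_sym Kip). Qed.

Lemma ipDr f g h : K f -> K g -> K h -> ip h (f + g) = ip h f + ip h g.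
Proof.
move=> Kf Kg Kh; rewrite (ip_sym (KD Kf Kg) Kh) ipDl // rmorphD /=.
by rewrite -!ip_sym.
Qed.

Lemma ipZr a f h : K f -> K h -> ip h (a *: f) = a^* * ip h f.
Proof.
by move=> Kf Kh; rewrite (ip_sym (KZ a Kf) Kh) ipZl // rmorphM /= -ip_sym.
Qed.

Lemma ipNr f h : K f -> K h -> ip h (- f) = - ip h f.
Proof. by move=> Kf Kh; rewrite (ip_sym (KN Kf) Kh) ipNl // rmorphN /= -ip_sym. Qed.

Lemma ipBr f g h : K f -> K g -> K h -> ip h (f - g) = ip h f - ip h g.
Proof. by move=> Kf Kg Kh; rewrite ipDr ?ipNr //; exact: KN. Qed.

Lemma seminorm_ge0 f : 0 <= sn f.
Proof. exact: sqrtr_ge0. Qed.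

Lemma seminorm_sqr f : K f -> ip f f = (sn f ^+ 2)%:C.
Proof.
move=> Kf; have f0 := semi_inner_ip_ge0 Kip Kf.
by rewrite sqr_sqrtr -?ge0_ReE // -ler0c -ge0_ReE.
Qed.

Lemma Re_ip_self f : K f -> complex.Re (ip f f) = sn f ^+ 2.
Proof. by move=> /seminorm_sqr ->. Qed.

Lemma seminormD_sqr f g : K f -> K g ->
  sn (f + g) ^+ 2 = sn f ^+ 2 + 2 * complex.Re (ip f g) + sn g ^+ 2.
Proof.
move=> Kf Kg; have Kfg := KD Kf Kg.
rewrite -!Re_ip_self // ipDl // !ipDr // !ReD [ip g f]ip_sym // ReJ; ring.
Qed.

Lemma seminormZ a f : K f -> sn (a *: f) = cmod a * sn f.
Proof.
move=> Kf; have Kaf := KZ a Kf; apply/eqP.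
rewrite -(@eqrXn2 _ 2) ?mulr_ge0 ?seminorm_ge0 ?cmod_ge0 //; apply/eqP/complexI.
by rewrite -seminorm_sqr // ipZl // ipZr // mulrA mulcJ seminorm_sqr // exprMn
  (realcM (cmod a ^+ 2)).
Qed.

Lemma seminormN f : K f -> sn (- f) = sn f.
Proof. by move=> Kf; rewrite -scaleN1r seminormZ // cmodN cmod1 mul1r. Qed.

Lemma seminorm_distC f g : K f -> K g -> sn (f - g) = sn (g - f).
Proof. by move=> Kf Kg; rewrite -seminormN ?opprB //; exact: KB. Qed.

Lemma seminormB_sqr f g : K f -> K g ->
  sn (f - g) ^+ 2 = sn f ^+ 2 - 2 * complex.Re (ip f g) + sn g ^+ 2.
Proof.
move=> Kf Kg; have Kg' := KN Kg.
rewrite seminormD_sqr // ipNr // ReN seminormN //; ring.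
Qed.

(** The squared norm of [f - t b g], where [b] is the inner product, is a nonnegative quadratic in
    the real [t]. Since [ip] is only semidefinite, [sn g = 0] is treated apart. *)
Lemma cauchy_schwarz f g : K f -> K g -> cmod (ip f g) <= sn f * sn g.
Proof.
move=> Kf Kg; set b := ip f g.
have key (t : R) : 0 <= sn f ^+ 2 - 2 * t * cmod b ^+ 2 + (t * cmod b * sn g) ^+ 2.
  have Kg' := KZ (t%:C * b) Kg.
  have := sqr_ge0 (sn (f - (t%:C * b) *: g)).
  rewrite seminormB_sqr // ipZr // seminormZ // !cmodM cmod_real rmorphM /=.
  rewrite realcJ -mulrA ReZ [_ * ip f g]mulrC mulcJ /= mulrA.
  by rewrite !exprMn real_normK ?num_real.
have [f0 g0 b0] := And3 (seminorm_ge0 f) (seminorm_ge0 g) (cmod_ge0 b).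
rewrite -(@ler_pXn2r _ 2) ?nnegrE ?mulr_ge0 //.
have [g_eq0|g_neq0] := eqVneq (sn g) 0.
  have [->|b_neq0] := eqVneq (cmod b) 0; first by rewrite expr0n sqr_ge0.
  (* The quadratic is now affine in [t], and this [t] gives it the value -1. *)
  have := key ((sn f ^+ 2 + 1) / (2 * cmod b ^+ 2)).
  rewrite g_eq0 mulr0 expr0n addr0 /=.
  have -> : 2 * ((sn f ^+ 2 + 1) / (2 * cmod b ^+ 2)) * cmod b ^+ 2 = sn f ^+ 2 + 1.
    by field.
  by rewrite opprD addrA subrr sub0r oppr_ge0 ler10.
have g_gt0 : 0 < sn g ^+ 2 by rewrite exprn_gt0 // lt_def g_neq0.
(* The minimiser of the quadratic. *)
have := key (sn g ^- 2).
have -> : sn f ^+ 2 - 2 * sn g ^- 2 * cmod b ^+ 2 + (sn g ^- 2 * cmod b * sn g) ^+ 2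
   = sn f ^+ 2 - cmod b ^+ 2 / sn g ^+ 2 by field.
by rewrite subr_ge0 ler_pdivrMr // exprMn.
Qed.

Lemma seminormD f g : K f -> K g -> sn (f + g) <= sn f + sn g.
Proof.
move=> Kf Kg; rewrite -(@ler_pXn2r _ 2) ?nnegrE ?addr_ge0 ?seminorm_ge0 //.
rewrite seminormD_sqr // sqrrD lerD2r lerD2l mulr2n.
have := le_trans (le_trans (ler_norm _) (Re_le_cmod _)) (cauchy_schwarz Kf Kg).
by lra.
Qed.

Lemma parallelogram f g : K f -> K g ->
  sn (f + g) ^+ 2 + sn (f - g) ^+ 2 = 2 * sn f ^+ 2 + 2 * sn g ^+ 2.
Proof. by move=> Kf Kg; rewrite seminormD_sqr // seminormB_sqr //; ring. Qed.

Lemma K_sum (I : Type) (r : seq I) (P : pred I) (F : I -> V) :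
  (forall i, K (F i)) -> K (\sum_(i <- r | P i) F i).
Proof.
move=> KF; elim/big_ind: _ => //; [exact: semi_inner0 Kip | exact: KD].
Qed.

Lemma seminorm_sum (I : Type) (r : seq I) (F : I -> V) :
  (forall i, K (F i)) -> sn (\sum_(i <- r) F i) <= \sum_(i <- r) sn (F i).
Proof.
move=> KF; elim: r => [|i r IH]; rewrite ?big_nil ?big_cons.
  by rewrite /seminorm ip0l ?sqrtr0 //; exact: semi_inner0 Kip.
by apply: le_trans (seminormD _ _) _; rewrite ?lerD2l //; exact: K_sum.
Qed.

Lemma ip_suml (I : Type) (r : seq I) (a : I -> R[i]) (F : I -> V) h :
  (forall i, K (F i)) -> K h ->
  ip (\sum_(i <- r) a i *: F i) h = \sum_(i <- r) a i * ip (F i) h.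
Proof.
move=> KF Kh; have KaF i : K (a i *: F i) by exact: KZ.
elim: r => [|i r IH]; rewrite ?big_nil ?big_cons; first exact: ip0l.
by rewrite ipDl ?IH ?ipZl //; exact: K_sum.
Qed.

Lemma ip_sumr (I : Type) (r : seq I) (a : I -> R[i]) (F : I -> V) h :
  (forall i, K (F i)) -> K h ->
  ip h (\sum_(i <- r) a i *: F i) = \sum_(i <- r) (a i)^* * ip h (F i).
Proof.
move=> KF Kh; have KaF i : K (a i *: F i) by exact: KZ.
rewrite ip_sym //; last exact: K_sum.
rewrite ip_suml // rmorph_sum /=; apply: eq_bigr => i _.
by rewrite rmorphM /= -ip_sym.
Qed.

(** For [f], [g] the kernel functions at [a], [b], the four coefficients are exactly the factors
    that clear the denominators of the kernel. *)
Lemma ip_shift_defect f g (a b : R[i]) : K f -> K g ->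
  ip (f - g) (f - g) - ip (a^* *: f - b^* *: g) (a^* *: f - b^* *: g) =
  (1 - a * a^*) * ip f f - (1 - b * a^*) * ip f g - (1 - a * b^*) * ip g f
  + (1 - b * b^*) * ip g g.
Proof.
move=> Kf Kg; have [Kaf Kbg] := (KZ a^* Kf, KZ b^* Kg).
have [Kfg Kab] := (KB Kf Kg, KB Kaf Kbg).
rewrite (ipBl Kf Kg Kfg) (ipBr Kf Kg Kf) (ipBr Kf Kg Kg).
rewrite (ipBl Kaf Kbg Kab) (ipBr Kaf Kbg Kaf) (ipBr Kaf Kbg Kbg).
rewrite !ipZl // !ipZr // !conjCK; ring.
Qed.

(** Write [a^* f - b^* g] as [a^* (f - g)] plus a multiple of [g]; the term [cmod a * sn (f - g)] is
    absorbed on the left. *)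
Lemma seminorm_shift_le f g (a b : R[i]) : K f -> K g -> cmod a < 1 ->
  sn (f - g) <= sn (a^* *: f - b^* *: g) ->
  sn (f - g) <= cmod (a - b) * sn g / (1 - cmod a).
Proof.
move=> Kf Kg a1; have Kfg := KB Kf Kg.
have -> : a^* *: f - b^* *: g = a^* *: (f - g) + (a - b)^* *: g.
  by rewrite scalerBr rmorphB /= scalerBl addrA subrK.
have [K1 K2] := (KZ a^* Kfg, KZ (a - b)^* Kg).
move=> /le_trans/(_ (seminormD K1 K2)); rewrite !seminormZ // !cmodJ => h.
by rewrite ler_pdivlMr ?subr_gt0 //; lra.
Qed.

End SemiInnerProduct.

(** * Weak cluster points of bounded families *)

Lemma nested_subset (I : Type) (F : nat -> set I) :
  (forall m, F m.+1 `<=` F m) -> forall i j, (i <= j)%N -> F j `<=` F i.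
Proof.
move=> Fsub i j /subnKC <-; elim: (j - i)%N => [|k IH]; rewrite ?addn0 // addnS.
exact: subset_trans IH.
Qed.

Section HilbertSpace.
Variables (R : realType) (V : lmodType R[i]).

Record hilbert (K : set V) (ip : V -> V -> R[i]) : Prop := Hilbert {
  hilbert_semi_inner : semi_inner K ip;
  hilbert_complete : forall u : nat -> V, (forall i, K (u i)) ->
    (forall e : R, 0 < e -> exists N : nat, forall i j : nat,
       (N <= i)%N -> (N <= j)%N -> seminorm ip (u i - u j) < e) ->
    exists2 f, K f & forall e : R, 0 < e -> exists N : nat, forall i : nat,
       (N <= i)%N -> seminorm ip (u i - f) < e }.

(** A substitute for the convex hull: the parallelogram law uses midpoints only, and balls and
    half-spaces are closed under them. *)
Inductive midpoint_hull (A : set V) : set V :=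
| midpoint_hull_in f : A f -> midpoint_hull A f
| midpoint_hull_half f g : midpoint_hull A f -> midpoint_hull A g ->
    midpoint_hull A ((2^-1 : R)%:C *: (f + g)).

Lemma midpoint_hullS (A B : set V) : A `<=` B -> midpoint_hull A `<=` midpoint_hull B.
Proof.
move=> AB f; elim=> {f} [f /AB|f g _ Bf _ Bg]; first exact: midpoint_hull_in.
exact: midpoint_hull_half.
Qed.

Variables (K : set V) (ip : V -> V -> R[i]) (HK : hilbert K ip).
Let Kip := hilbert_semi_inner HK.
Local Notation sn := (seminorm ip).

Lemma midpoint_hull_bounded (A : set V) (B : R) :
  (forall f, A f -> K f /\ sn f <= B) ->
  forall f, midpoint_hull A f -> K f /\ sn f <= B.
Proof.
move=> AB f; elim=> {f} [f /AB//|f g _ [Kf fB] _ [Kg gB]].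
have Kfg := KD Kip Kf Kg; split; first exact: KZ Kip _ _ Kfg.
rewrite (seminormZ Kip) // cmod_real ger0_norm ?invr_ge0 //.
by have := seminormD Kip Kf Kg; lra.
Qed.

Lemma midpoint_hull_halfspace (A : set V) (h : V) (c : R) :
  K h -> (forall f, A f -> K f /\ complex.Re (ip f h) <= c) ->
  forall f, midpoint_hull A f -> K f /\ complex.Re (ip f h) <= c.
Proof.
move=> Kh Ac f; elim=> {f} [f /Ac//|f g _ [Kf fB] _ [Kg gB]].
have Kfg := KD Kip Kf Kg; split; first exact: KZ Kip _ _ Kfg.
by rewrite (ipZl Kip) // ReZ (ipDl Kip) // ReD; lra.
Qed.

(* Nearly norm-minimal points of the convex hulls of the tails form a Cauchy
   sequence, by the parallelogram law. *)
Lemma weak_cluster_point (F : nat -> set V) (B : R) :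
  (forall m, F m.+1 `<=` F m) -> (forall m, F m !=set0) ->
  (forall f, F 0%N f -> K f /\ sn f <= B) ->
  exists2 g, K g & forall m h c, K h ->
    (forall f, F m f -> complex.Re (ip f h) <= c) -> complex.Re (ip g h) <= c.
Proof.
move=> Fsub Fn0 FB.
have Fmono := nested_subset Fsub.
pose C m := midpoint_hull (F m).
have CK m f : C m f -> K f /\ sn f <= B.
  move=> Cf; apply: (midpoint_hull_bounded FB).
  exact: midpoint_hullS (Fmono _ _ (leq0n m)) _ Cf.
pose S m := [set sn f | f in C m].
have S_inf m : has_inf (S m).
  split; first by have [f Ff] := Fn0 m; exists (sn f); exists f => //;
    exact: midpoint_hull_in.
  by exists 0 => _ [f _ <-]; exact: seminorm_ge0.
pose d m := inf (S m).
have d_le m f : C m f -> d m <= sn f.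
  by move=> Cf; apply: ge_inf; [case: (S_inf m)|exists f].
have d_ge0 m : 0 <= d m.
  by apply: lb_le_inf; [case: (S_inf m)|move=> _ [f _ <-]; exact: seminorm_ge0].
have d_mono i j : (i <= j)%N -> d i <= d j.
  move=> ij; apply: lb_le_inf; first by case: (S_inf j).
  by move=> _ [f Cf <-]; apply: d_le; exact: midpoint_hullS (Fmono _ _ ij) _ Cf.
have d_sup : has_sup (range d).
  split; first by exists (d 0%N); exists 0%N.
  exists B => _ [m _ <-]; have [f Ff] := Fn0 m.
  have Cf : C m f by exact: midpoint_hull_in.
  by apply: le_trans (d_le _ _ Cf) _; case: (CK _ _ Cf).
pose D := sup (range d).
have d_leD m : d m <= D by apply: ub_le_sup; [case: d_sup|exists m].
have /choice[v vP] : forall m, exists f, C m f /\ sn f < d m + m.+1%:R^-1.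
  move=> m; have e0 : 0 < m.+1%:R^-1 :> R by rewrite invr_gt0.
  by have [_ [f Cf <-] ?] := inf_adherent e0 (S_inf m); exists f.
have vK i : K (v i) by case: (vP i) => /CK[].
have D_ge0 : 0 <= D by apply: le_trans (d_leD 0%N).
have [|g Kg vg] := hilbert_complete HK vK.
  move=> e e_gt0.
  (* With norms at most [D + eta] and [D - eta <= d i], the parallelogram law bounds the squared
     distance by [16 D eta + 4 eta^2]. The summand [e ^+ 2] in the denominator ensures [eta <= 1],
     whence [eta^2 <= eta]. *)
  pose eta := e ^+ 2 / (16 * D + 5 + e ^+ 2).
  have e2_gt0 : 0 < e ^+ 2 by rewrite exprn_gt0.
  have den_gt0 : 0 < 16 * D + 5 + e ^+ 2 by lra.
  have eta_gt0 : 0 < eta by rewrite divr_gt0.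
  have etaE : eta * (16 * D + 5 + e ^+ 2) = e ^+ 2 by rewrite /eta; field;
    rewrite gt_eqF.
  have eta_le1 : eta <= 1 by rewrite ler_pdivrMr //; lra.
  have [_ [N1 _ <-]] := sup_adherent eta_gt0 d_sup; rewrite -/D => N1P.
  have [N2 N2P] : exists N, N.+1%:R^-1 < eta.
    have := near_infty_natSinv_lt (PosNum eta_gt0) => -[N _ NP].
    by exists N; exact: NP (leqnn N).
  exists (maxn N1 N2) => i j; rewrite !geq_max => /andP[N1i N2i] /andP[N1j N2j].
  wlog ij : i j N1i N2i N1j N2j / (i <= j)%N.
    by move=> W; case/orP: (leq_total i j) => [|/W];
      [exact: W|rewrite (seminorm_distC Kip) //; apply].
  have inv_lt k : (N2 <= k)%N -> k.+1%:R^-1 < eta :> R.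
    by move=> N2k; apply: le_lt_trans N2P; rewrite lef_pV2 ?posrE // ler_nat ltnS.
  have [[Ci vi] [Cj vj]] := (vP i, vP j).
  have Cij : C i ((2^-1 : R)%:C *: (v i + v j)).
    by apply: midpoint_hull_half => //; exact: midpoint_hullS (Fmono _ _ ij) _ Cj.
  have := d_le _ _ Cij; rewrite (seminormZ Kip) ?cmod_real; last exact: (KD Kip).
  rewrite ger0_norm ?invr_ge0 // => dij.
  have PL := parallelogram Kip (vK i) (vK j).
  have := inv_lt _ N2i; have := inv_lt _ N2j; have := d_leD i; have := d_leD j.
  have := d_mono _ _ N1i => ddi dj di ej ei.
  have vi' : sn (v i) <= D + eta by apply: le_trans (ltW vi) (lerD _ (ltW ei)).
  have vj' : sn (v j) <= D + eta by apply: le_trans (ltW vj) (lerD _ (ltW ej)).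
  have di' : D - eta <= d i by lra.
  have vi2 : sn (v i) ^+ 2 <= (D + eta) ^+ 2 by rewrite ler_pXn2r ?nnegrE
    ?seminorm_ge0 //; lra.
  have vj2 : sn (v j) ^+ 2 <= (D + eta) ^+ 2 by rewrite ler_pXn2r ?nnegrE
    ?seminorm_ge0 //; lra.
  have dij2 : (2 * d i) ^+ 2 <= sn (v i + v j) ^+ 2.
    by rewrite ler_pXn2r ?nnegrE ?seminorm_ge0 ?mulr_ge0 //; lra.
  have di2 : D ^+ 2 - 2 * D * eta <= d i ^+ 2.
    have := d_ge0 i; have [|] := leP eta D; nra.
  rewrite -(@ltr_pXn2r _ 2) ?nnegrE ?seminorm_ge0 // ?ltW //.
  have eta2 : eta ^+ 2 <= eta by rewrite expr2; nra.
  nra.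
exists g => // m h c Kh Fc.
(* A half-space containing [F m] contains its midpoint hull, hence the tail of [v], hence the strong
   limit of [v]. *)
have Cc f : C m f -> complex.Re (ip f h) <= c.
  move=> Cf; apply: (proj2 (midpoint_hull_halfspace (A := F m) Kh _ Cf)) => k Fk;
    split; last exact: Fc.
  by case: (FB k) => //; exact: Fmono (leq0n m) _ Fk.
apply/ler_addgt0Pr => e e_gt0.
have [|N NP] := vg (e / (sn h + 1)).
  by rewrite divr_gt0 // ltr_wpDl ?seminorm_ge0.
pose i := maxn m N.
have Kgv := KB Kip Kg (vK i).
have -> : ip g h = ip (v i) h + ip (g - v i) h by rewrite -(ipDl Kip) // addrCA
  subrr addr0.
rewrite ReD lerD //.
  by apply/Cc/(midpoint_hullS (Fmono _ _ (leq_maxl m N))); case: (vP i).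
apply: le_trans (ler_norm _) (le_trans (Re_le_cmod _) _).
apply: le_trans (cauchy_schwarz Kip _ _) _ => //.
have := NP i (leq_maxr m N);
  rewrite (seminorm_distC Kip) // ltr_pdivlMr ?ltr_wpDl ?seminorm_ge0 //.
have := seminorm_ge0 ip (g - v i); have := seminorm_ge0 ip h; nra.
Qed.

End HilbertSpace.

(** * Weak limits and uniform boundedness *)

Section WeakLimit.
Variables (R : realType) (V : lmodType R[i]) (K : set V) (ip : V -> V -> R[i]).
Hypothesis HK : hilbert K ip.
Let Kip := hilbert_semi_inner HK.
Local Notation sn := (seminorm ip).

(** A cluster point takes the limit values: testing it in the direction [z *: d], where [z] is the
    discrepancy at [d], gives [|z|^2 <= |z| e] for every [e]. The half-space property is kept in the
    conclusion because [weak_limit] uses it again. *)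
Lemma weak_limit_exists (F : nat -> set V) (B : R) (J : Type)
    (D : J -> V) (l : J -> R[i]) :
  (forall m, F m.+1 `<=` F m) -> (forall m, F m !=set0) ->
  (forall f, F 0%N f -> K f /\ sn f <= B) -> (forall j, K (D j)) ->
  (forall j (e : R), 0 < e ->
     exists m, forall f, F m f -> cmod (ip f (D j) - l j) <= e) ->
  exists g, [/\ K g, forall j, ip g (D j) = l j &
   forall m h c, K h ->
    (forall f, F m f -> complex.Re (ip f h) <= c) -> complex.Re (ip g h) <= c].
Proof.
move=> Fsub Fn0 FB DK Fl.
have [g Kg gP] := weak_cluster_point HK Fsub Fn0 FB.
exists g; split=> // j; have Kd := DK j; move: (D j) (l j) (Fl j) Kd => d lj {}Fl Kd.
apply/eqP; rewrite -subr_eq0 -cmod_eq0; set z := ip g d - lj.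
rewrite eq_le cmod_ge0 andbT; apply/ler_addgt0Pr => e e_gt0; rewrite add0r.
have [m Fm] := Fl e e_gt0.
have FK f : F m f -> K f.
  by move=> Ff; case: (FB f) => //; exact: nested_subset Fsub _ _ (leq0n m) _ Ff.
have := gP m (z *: d) (complex.Re (z^* * lj) + cmod z * e) (KZ Kip z Kd).
rewrite (ipZr Kip) // => gle.
have {gle}/gle : forall f, F m f ->
    complex.Re (ip f (z *: d)) <= complex.Re (z^* * lj) + cmod z * e.
  move=> f Ff; have Kf := FK f Ff; rewrite (ipZr Kip) //.
  have -> : z^* * ip f d = z^* * lj + z^* * (ip f d - lj) by ring.
  rewrite ReD lerD2l; apply: le_trans (ler_norm _) (le_trans (Re_le_cmod _) _).
  by rewrite cmodM cmodJ ler_wpM2l ?cmod_ge0 ?Fm.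
have -> : z^* * ip g d = z^* * lj + z * z^* by rewrite /z; ring.
rewrite mulcJ ReD lerD2l /= expr2.
have [->|z_neq0] := eqVneq (cmod z) 0; first by move=> _; exact: ltW.
by rewrite ler_pM2l // lt_def z_neq0 cmod_ge0.
Qed.

(** Totality makes the cluster point unique. If convergence failed in some half-space, the offending
    elements [G] would form a nested family with a cluster point of its own, equal to [g] by
    totality yet separated from it. The directions [h], [- h] and their multiples by ['i] bound the
    modulus. *)
Lemma weak_limit (F : nat -> set V) (B : R) (J : Type)
    (D : J -> V) (l : J -> R[i]) :
  (forall m, F m.+1 `<=` F m) -> (forall m, F m !=set0) ->
  (forall f, F 0%N f -> K f /\ sn f <= B) -> (forall j, K (D j)) ->
  (forall f, K f -> (forall j, ip f (D j) = 0) -> f = 0) ->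
  (forall j (e : R), 0 < e ->
     exists m, forall f, F m f -> cmod (ip f (D j) - l j) <= e) ->
  exists g, [/\ K g, forall j, ip g (D j) = l j &
   forall h (e : R), K h -> 0 < e ->
     exists m, forall f, F m f -> cmod (ip f h - ip g h) <= e].
Proof.
move=> Fsub Fn0 FB DK Dtot Fl.
have [g [Kg gD _]] := weak_limit_exists Fsub Fn0 FB DK Fl.
exists g; split=> //.
have Fmono := nested_subset Fsub.
have FK m f : F m f -> K f by move=> /(Fmono _ _ (leq0n m)) /FB[].
have half h e : K h -> 0 < e ->
    exists m, forall f, F m f -> complex.Re (ip f h) <= complex.Re (ip g h) + e.
  move=> Kh e_gt0; apply: contrapT => nex.
  pose G m := F m `&` [set f | complex.Re (ip g h) + e <= complex.Re (ip f h)].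
  have GF m : G m `<=` F m by move=> f [].
  have Gsub m : G m.+1 `<=` G m by move=> f [/Fsub].
  have Gn0 m : G m !=set0.
    apply: contrapT => Gm0; apply: nex; exists m => f Ff.
    by rewrite leNgt; apply/negP => /ltW fge; apply: Gm0; exists f.
  have Gl j e' : 0 < e' -> exists m, forall f, G m f -> cmod (ip f (D j) - l j) <= e'.
    by move=> /(Fl j _)[m Fm]; exists m => f /GF /Fm.
  have [g' [Kg' g'D g'P]] := weak_limit_exists Gsub Gn0 (fun f Gf => FB f (GF _ _
    Gf)) DK Gl.
  have /eqP : g' - g = 0.
    apply: Dtot => [|j]; first exact: KB Kip _ _ _ _.
    by rewrite (ipBl Kip) ?g'D ?gD ?subrr.
  rewrite subr_eq0 => /eqP eg.
  have : complex.Re (ip g' (- h)) <= - (complex.Re (ip g h) + e).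
    apply: (g'P 0%N) => [|f [Ff fge]]; first exact: KN Kip _ _.
    by rewrite (ipNr Kip) // ?ReN ?lerN2 //; exact: FK Ff.
  by rewrite (ipNr Kip) // ReN eg; lra.
have absRe h e : K h -> 0 < e ->
    exists m, forall f, F m f -> `|complex.Re (ip f h - ip g h)| <= e.
  move=> Kh e_gt0; have [m1 F1] := half h e Kh e_gt0.
  have [m2 F2] := half (- h) e (KN Kip Kh) e_gt0.
  exists (maxn m1 m2) => f Ff.
  have /F1 f1 := Fmono _ _ (leq_maxl m1 m2) _ Ff.
  have /F2 := Fmono _ _ (leq_maxr m1 m2) _ Ff.
  have Kf := FK _ _ Ff.
  by rewrite !(ipNr Kip) // ReD !ReN ler_norml => f2; apply/andP; split; lra.
move=> h e Kh e_gt0; have e2_gt0 : 0 < e / 2 by rewrite divr_gt0.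
have [m1 F1] := absRe h _ Kh e2_gt0.
have [m2 F2] := absRe ('i *: h) _ (KZ Kip _ Kh) e2_gt0.
exists (maxn m1 m2) => f Ff.
have /F1 f1 := Fmono _ _ (leq_maxl m1 m2) _ Ff.
have /F2 := Fmono _ _ (leq_maxr m1 m2) _ Ff.
have Kf := FK _ _ Ff.
rewrite !(ipZr Kip) // -mulrBr => f2.
apply: le_trans (cmod_le_ReIm _) _; rewrite [e]splitr lerD //.
suff <- : `|complex.Re ('i^* * (ip f h - ip g h))| = `|complex.Im (ip f h - ip g
  h)| by [].
case: (ip f h - ip g h) => a b /=; congr `|_|; ring.
Qed.

(* Sokal's gliding hump: moving by [3^-m] in the direction of an element of
   norm at least [4^m] changes the value of the corresponding functional by
   more than all later moves together can undo. *)
Lemma uniform_boundedness (F : nat -> set V) :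
  (forall m, F m `<=` K) -> (forall m, F m.+1 `<=` F m) ->
  (forall f, K f -> exists m, exists B : R, forall g, F m g -> cmod (ip f g) <= B) ->
  exists m, exists B : R, forall g, F m g -> sn g <= B.
Proof.
move=> FK Fsub Fbd; apply: contrapT => nex.
have /choice[w wP] : forall m, exists g, F m g /\ 4 ^+ m < sn g.
  move=> m; apply: contrapT => nw; apply: nex; exists m, (4 ^+ m) => g Fg.
  by rewrite leNgt; apply/negP => ?; apply: nw; exists g.
have Kw m : K (w m) by apply: (FK m); case: (wP m).
have w_gt0 m : 0 < sn (w m) by case: (wP m) => _; apply: le_lt_trans; rewrite exprn_ge0.
pose xi m := ((3 ^- m / sn (w m) : R)%:C *: w m).
have Kxi m : K (xi m) by exact: KZ Kip _ _ _.
have xi_norm m : sn (xi m) = 3 ^- m.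
  rewrite (seminormZ Kip) // cmod_real ger0_norm;
    last by rewrite divr_ge0 ?invr_ge0 ?exprn_ge0 ?seminorm_ge0.
  by rewrite divfK // gt_eqF.
have xi_w m : cmod (ip (xi m) (w m)) = 3 ^- m * sn (w m).
  rewrite (ipZl Kip) // (seminorm_sqr Kip) // -realcM cmod_real.
  have w0 : sn (w m) != 0 by rewrite gt_eqF.
  have p0 : (3 : R) ^+ m != 0 by rewrite expf_neq0.
  have -> : 3 ^- m / sn (w m) * sn (w m) ^+ 2 = 3 ^- m * sn (w m) by field; rewrite p0.
  by rewrite ger0_norm // mulr_ge0 ?invr_ge0 ?exprn_ge0 ?seminorm_ge0.
(* Of [x + xi m] and [x - xi m], the one with the larger value at [w m]; that value is at least the
   value of [xi m]. *)
pose step m x := if cmod (ip (x - xi m) (w m)) <= cmod (ip (x + xi m) (w m))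
  then x + xi m else x - xi m.
pose fix x m := if m is m'.+1 then step m' (x m') else 0.
have Kx m : K (x m).
  elim: m => [|m Kx] /=; first exact: semi_inner0 Kip.
  by rewrite /step; case: ifP => _; [exact: KD Kip _ _ _ _|exact: KB Kip _ _ _ _].
have x_step m : sn (x m.+1 - x m) = 3 ^- m.
  rewrite /= /step; case: ifP => _; first by rewrite addrC addKr xi_norm.
  by rewrite addrC addKr (seminormN Kip) // xi_norm.
have x_w m : 3 ^- m * sn (w m) <= cmod (ip (x m.+1) (w m)).
  rewrite -xi_w /= /step.
  have [Kp Km] := (KD Kip (Kx m) (Kxi m), KB Kip (Kx m) (Kxi m)).
  have : cmod (ip (xi m) (w m)) *+ 2 <=
      cmod (ip (x m + xi m) (w m)) + cmod (ip (x m - xi m) (w m)).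
    have -> : cmod (ip (xi m) (w m)) *+ 2 = cmod (ip (xi m) (w m) + ip (xi m) (w m)).
      rewrite -[X in cmod (X + _)]mul1r -[X in cmod (_ + X)]mul1r -mulrDl cmodM.
      by rewrite -(realcD 1 1) cmod_real -[1 + 1]/(2%:R) normr_nat mulr_natl.
    apply: le_trans (cmodB _ _); rewrite le_eqVlt; apply/orP; left; apply/eqP.
    by congr cmod; rewrite -(ipDl Kip) // -(ipBl Kip) //; congr ip;
      rewrite opprB [xi m - _]addrC addrACA subrr add0r.
  by rewrite mulr2n; case: (leP (cmod (ip (x m - xi m) (w m)))); lra.
(* A geometric sum of the steps from [i] to [i + k - 1]. *)
have x_tail i k : sn (x (i + k)%N - x i) <= 3 / 2 * 3 ^- i * (1 - 3 ^- k).
  elim: k => [|k IH].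
    by rewrite addn0 !subrr /seminorm (ip0l Kip) ?sqrtr0 ?expr0 ?invr1 ?subrr
      ?mulr0 //; exact: semi_inner0 Kip.
  rewrite addnS -(subrKA (x (i + k)%N)).
  have K1 := KB Kip (Kx (i + k).+1) (Kx (i + k)%N).
  have K2 := KB Kip (Kx (i + k)%N) (Kx i).
  apply: le_trans (seminormD Kip K1 K2) _; rewrite x_step.
  apply: le_trans (lerD (lexx _) IH) _.
  rewrite exprD exprS !invfM le_eqVlt; apply/orP; left; apply/eqP; field.
  by rewrite !expf_neq0.
have x_tail_lt i j : (i <= j)%N -> sn (x j - x i) <= 3 / 2 * 3 ^- i.
  move=> /subnKC <-; apply: le_trans (x_tail _ _) _.
  have a0 : 0 < (3 : R) ^- i by rewrite invr_gt0 exprn_gt0.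
  have b0 : 0 < (3 : R) ^- (j - i) by rewrite invr_gt0 exprn_gt0.
  nra.
have small e : 0 < e -> exists N, 3 * 3 ^- N < e :> R.
  move=> e0; have e30 : 0 < e / 3 by rewrite divr_gt0.
  have := near_infty_natSinv_lt (PosNum e30) => -[N _ NP]; exists N.
  have := NP N (leqnn N) => /= Nlt.
  have : (3 : R) ^- N <= N.+1%:R^-1.
    rewrite lef_pV2 ?posrE ?exprn_gt0 // -natrX ler_nat.
    by elim: N {NP Nlt} => // N IH; rewrite expnS;
      apply: leq_trans (leq_mul (leqnn 3) IH); rewrite mulSn -addn1 leq_add2l muln_gt0.
  by move=> le3; have := le_lt_trans le3 Nlt; lra.
have [|f Kf xf] := hilbert_complete HK Kx.
  move=> e /small[N Ne]; exists N => i j Ni Nj; apply: le_lt_trans Ne.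
  rewrite -(subrKA (x N)) (le_trans (seminormD Kip _ _)) //; try exact: KB Kip _ _ _ _.
  rewrite (seminorm_distC Kip (Kx N)) //.
  by have := x_tail_lt _ _ Ni; have := x_tail_lt _ _ Nj; lra.
have f_tail m : sn (x m.+1 - f) <= 3 ^- m / 2.
  apply/ler_addgt0Pr => e /xf[N NP].
  pose j := maxn m.+1 N; rewrite -(subrKA (x j)).
  apply: le_trans (seminormD Kip _ _) _; try exact: KB Kip _ _ _ _.
  rewrite (seminorm_distC Kip (Kx _)) // lerD //; last by rewrite ltW // NP // leq_maxr.
  apply: le_trans (x_tail_lt _ _ (leq_maxl _ _)) _.
  by rewrite exprS invfM le_eqVlt; apply/orP; left; apply/eqP; field; rewrite expf_neq0.
(* At least half of the gain [3^-m * sn (w m)] survives in the limit. It exceeds [(4/3)^m], which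
   grows at least linearly by Bernoulli's inequality. *)
have f_w m : (1 + m%:R / 3) / 2 <= cmod (ip f (w m)).
  have Kxf := KB Kip (Kx m.+1) Kf.
  have h1 : cmod (ip (x m.+1) (w m)) <= cmod (ip f (w m)) + cmod (ip (x m.+1 - f)
    (w m)).
    by apply: le_trans (cmodD _ _); rewrite -(ipDl Kip) // addrCA subrr addr0.
  have h2 := cauchy_schwarz Kip Kxf (Kw m).
  have h3 : sn (x m.+1 - f) * sn (w m) <= 3 ^- m / 2 * sn (w m).
    by rewrite ler_wpM2r ?seminorm_ge0.
  have h4 := x_w m.
  have h5 : 3 ^- m * 4 ^+ m <= 3 ^- m * sn (w m).
    by rewrite ler_wpM2l ?invr_ge0 ?exprn_ge0 // ltW //; case: (wP m).
  have h6 : 1 + m%:R / 3 <= 3 ^- m * 4 ^+ m :> R.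
    elim: m {h1 h2 h3 h4 h5 Kxf} => [|m IH]; first by rewrite expr0 invr1; lra.
    rewrite exprS (exprS 4) invfM.
    have -> : 3^-1 * 3 ^- m * (4 * 4 ^+ m) = 4 / 3 * (3 ^- m * 4 ^+ m) :> R by ring.
    have m0 : 0 <= m%:R :> R by [].
    by rewrite -natr1; lra.
  lra.
have [m [B FB]] := Fbd f Kf.
have [k kP] : exists k, B < k%:R :> R by exists (Num.truncn B).+1; exact: truncnS_gt.
(* The lower bound [(1 + j / 3) / 2] is then at least [k + 1/2], which exceeds [B]. *)
pose j := maxn m (6 * k).
have := FB _ (nested_subset Fsub (leq_maxl _ _) (proj1 (wP j))); have := f_w j.
have : (6 * k)%:R <= j%:R :> R by rewrite ler_nat leq_maxr.
by rewrite natrM; lra.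
Qed.

End WeakLimit.

(** * Matrices and Stolz regions *)

Section Euclidean.
Variables (R : realType) (n : nat).
Implicit Types (x y : 'cV[R[i]]_n) (A : 'M[R[i]]_n).

Lemma cdotE x y : cdot x y = \sum_i x i 0 * (y i 0)^*.
Proof. by rewrite /cdot mxE; apply: eq_bigr => i _; rewrite !mxE mulrC. Qed.

Lemma cdot_semi_inner : semi_inner setT (@cdot R n).
Proof.
split=> //.
- move=> a f g h _ _ _; rewrite !cdotE mulr_sumr -big_split /=.
  by apply: eq_bigr => i _; rewrite !mxE mulrDl mulrA.
- move=> f g _ _; rewrite !cdotE rmorph_sum /=.
  by apply: eq_bigr => i _; rewrite rmorphM /= conjCK mulrC.
- by move=> f _; rewrite cdotE sumr_ge0 // => i _; rewrite mul_conjC_ge0.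
Qed.

Let Cip := cdot_semi_inner.

Lemma cnorm_ge0 x : 0 <= cnorm x.
Proof. exact: seminorm_ge0. Qed.

Lemma cnorm_sqr x : cdot x x = (cnorm x ^+ 2)%:C.
Proof. exact: seminorm_sqr Cip _ _. Qed.

Lemma cdotDl x y z : cdot (x + y) z = cdot x z + cdot y z.
Proof. exact: ipDl Cip _ _ _ _ _ _. Qed.

Lemma cdotBl x y z : cdot (x - y) z = cdot x z - cdot y z.
Proof. exact: ipBl Cip _ _ _ _ _ _. Qed.

Lemma cdotBr x y z : cdot z (x - y) = cdot z x - cdot z y.
Proof. exact: ipBr Cip _ _ _ _ _ _. Qed.

Lemma cdotZl a x y : cdot (a *: x) y = a * cdot x y.
Proof. exact: ipZl Cip _ _ _ _ _. Qed.

Lemma cdotC x y : cdot y x = (cdot x y)^*%R.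
Proof. exact: ip_sym Cip _ _ _ _. Qed.

Lemma cdot_cs x y : cmod (cdot x y) <= cnorm x * cnorm y.
Proof. exact: cauchy_schwarz Cip _ _ _ _. Qed.

Lemma cnormD x y : cnorm (x + y) <= cnorm x + cnorm y.
Proof. exact: seminormD Cip _ _ _ _. Qed.

Lemma cnormZ a x : cnorm (a *: x) = cmod a * cnorm x.
Proof. exact: seminormZ Cip _ _ _. Qed.

Lemma cnormN x : cnorm (- x) = cnorm x.
Proof. exact: seminormN Cip _ _. Qed.

Lemma cnorm_sum (I : Type) (r : seq I) (F : I -> 'cV[R[i]]_n) :
  cnorm (\sum_(i <- r) F i) <= \sum_(i <- r) cnorm (F i).
Proof. by apply: (seminorm_sum Cip). Qed.

Lemma cdot_delta x i : cdot x (delta_mx i 0) = x i 0.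
Proof.
rewrite cdotE (bigD1 i) //= big1 ?addr0 => [|j ji]; rewrite !mxE !eqxx /=.
  by rewrite rmorph1 mulr1.
by rewrite (negbTE ji) rmorph0 mulr0.
Qed.

Lemma cdot_mx_delta A i j : cdot (A *m delta_mx j 0) (delta_mx i 0) = A i j.
Proof. by rewrite cdot_delta -colE mxE. Qed.

Lemma cnorm_delta (i : 'I_n) : cnorm (delta_mx i 0 : 'cV[R[i]]_n) = 1.
Proof. by rewrite /cnorm cdot_delta !mxE !eqxx sqrtr1. Qed.

Lemma cmod_coord_le x i : cmod (x i 0) <= cnorm x.
Proof. by rewrite -cdot_delta; apply: le_trans (cdot_cs _ _) _;
  rewrite cnorm_delta mulr1. Qed.

Lemma col_sum_delta x : x = \sum_i x i 0 *: delta_mx i 0.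
Proof.
apply/matrixP => i j; rewrite ord1 summxE (bigD1 i) //= big1 => [|k ki];
  rewrite !mxE !eqxx /=.
  by rewrite mulr1 addr0.
by rewrite eq_sym (negbTE ki) mulr0.
Qed.

Lemma cnorm_le_sum x : cnorm x <= \sum_i cmod (x i 0).
Proof.
rewrite {1}[x]col_sum_delta; apply: le_trans (cnorm_sum _ _) _.
by apply: ler_sum => i _; rewrite cnormZ cnorm_delta mulr1.
Qed.

Lemma cnorm0_eq0 x : cnorm x = 0 -> x = 0.
Proof.
move=> x0; apply/matrixP => i j; rewrite ord1 mxE; apply/eqP.
by rewrite -cmod_eq0 eq_le cmod_ge0 andbT -x0 cmod_coord_le.
Qed.

Lemma cdot_inj x y : (forall z, cdot x z = cdot y z) -> x = y.
Proof. by move=> xy; apply/matrixP => i j; rewrite ord1 -!cdot_delta xy. Qed.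

Lemma cdot_mulmx A x y : cdot (A *m x) y = cdot x (A ^t* *m y).
Proof. by rewrite /cdot trmx_mul map_mxM -map_trmx trmxCK mulmxA. Qed.

Lemma cnorm_mulmx_le A x :
  cnorm (A *m x) <= (\sum_i \sum_j cmod (A i j)) * cnorm x.
Proof.
apply: le_trans (cnorm_le_sum _) _; rewrite mulr_suml.
apply: ler_sum => i _; rewrite mxE mulr_suml.
elim/big_rec2: _ => [|j a b _ IH]; first by rewrite cmod0.
apply: le_trans (cmodD _ _) (lerD _ IH).
by rewrite cmodM ler_wpM2l ?cmod_ge0 ?cmod_coord_le.
Qed.

Lemma cnorm_mulmx_entries_le A (c : R) x :
  (forall i j, cmod (A i j) <= c) -> cnorm (A *m x) <= n%:R ^+ 2 * c * cnorm x.
Proof.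
move=> Ac; apply: le_trans (cnorm_mulmx_le _ _) _; rewrite ler_wpM2r ?cnorm_ge0 //.
apply: le_trans (_ : \sum_(i < n) \sum_(j < n) c <= _).
  by apply: ler_sum => i _; apply: ler_sum => j _.
by rewrite !sumr_const !card_ord -mulrnA -[c *+ _]mulr_natl natrM expr2.
Qed.

Lemma mulmx_sum_delta A x :
  A *m x = \sum_i x i 0 *: (A *m delta_mx i 0).
Proof.
rewrite {1}[x]col_sum_delta mulmx_sumr; apply: eq_bigr => i _.
by rewrite -scalemxAr.
Qed.

(** The entrywise bound shows that the set in [opnorm] is bounded above, so that [sup] is its least
    upper bound. *)
Lemma opnormM A x : cnorm (A *m x) <= opnorm A * cnorm x.
Proof.
pose c : R := \sum_i \sum_j cmod (A i j).
have c0 : 0 <= c.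
  by apply: sumr_ge0 => i _; apply: sumr_ge0 => j _; exact: cmod_ge0.
have Ac := cnorm_mulmx_le A; rewrite -/c in Ac.
have [/cnorm0_eq0 ->|x_neq0] := eqVneq (cnorm x) 0.
  by rewrite mulmx0 /cnorm -[cdot 0 0]/(cdot 0 0) (ip0l Cip) // sqrtr0 mulr0.
have x_gt0 : 0 < cnorm x by rewrite lt_def x_neq0 cnorm_ge0.
rewrite -ler_pdivrMr //.
have -> : cnorm (A *m x) / cnorm x = cnorm (A *m ((cnorm x)^-1%:C *: x)).
  by rewrite -scalemxAr cnormZ cmod_real ger0_norm ?invr_ge0 ?cnorm_ge0 // mulrC.
apply: ub_le_sup; last first.
  by eexists; last reflexivity;
    rewrite /= cnormZ cmod_real ger0_norm ?invr_ge0 ?cnorm_ge0 // mulVf.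
exists c => _ [y /= y1 <-]; apply: le_trans (Ac y) _.
by rewrite -[leRHS]mulr1 ler_wpM2l.
Qed.

Lemma opnorm_le A c : 0 <= c -> (forall x, cnorm (A *m x) <= c * cnorm x) -> opnorm
  A <= c.
Proof.
move=> c0 Ac; apply: ge_sup; last first.
  by move=> _ [y /= y1 <-]; apply: le_trans (Ac y) _; rewrite -[leRHS]mulr1 ler_wpM2l.
exists (cnorm (A *m 0)); exists 0 => //=.
by rewrite /cnorm (ip0l Cip) // sqrtr0.
Qed.

Lemma unitary_isometry A x y : A \is unitarymx -> cdot (A ^t* *m x) (A ^t* *m y) =
  cdot x y.
Proof. by move=> /unitarymxP AA; rewrite cdot_mulmx trmxCK mulmxA AA mul1mx. Qed.

Lemma unitary_mulCmx A : A \is unitarymx -> A ^t* *m A = 1%:M.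
Proof. by rewrite -trmxC_unitary => /unitarymxP; rewrite trmxCK. Qed.

Lemma unitary_cnorm A x : A \is unitarymx -> cnorm (A ^t* *m x) = cnorm x.
Proof. by move=> Au; rewrite /cnorm unitary_isometry. Qed.

End Euclidean.

(** * Stolz regions and the nontangential filter *)

Section StolzFilter.
Variables (R : realType) (zeta : R[i]).
Hypothesis zeta1 : cmod zeta = 1.

(** Truncation at the radii [m.+1%:R^-1] gives each aperture a decreasing countable base, the form
    required by the weak limit lemmas. *)
Definition stolz (M : R) (m : nat) : set (disc R) :=
  [set z | cmod (sval z - zeta) < m.+1%:R^-1 /\
           cmod (sval z - zeta) < M * (1 - cmod (sval z))].

Definition stolz_nbhs (M : R) : set_system (disc R) :=
  filter_from setT (stolz M).

Lemma disc_lt1 (z : disc R) : cmod (sval z) < 1.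
Proof. by case: z => z /= ; rewrite normE -realc1 ltcR. Qed.

Lemma stolzS M i j : (i <= j)%N -> stolz M j `<=` stolz M i.
Proof.
move=> ij z [z1 z2]; split=> //; apply: lt_le_trans z1 _.
by rewrite lef_pV2 ?posrE // ler_nat.
Qed.

Lemma stolz_nonempty M m : 1 < M -> stolz M m !=set0.
Proof.
(* With [m.+2] the distance [1 - r] to [zeta] is strictly below [m.+1%:R^-1]. *)
move=> M1; pose r : R := 1 - m.+2%:R^-1.
have m2_gt0 : 0 < m.+2%:R^-1 :> R by rewrite invr_gt0.
have m2_le1 : m.+2%:R^-1 <= 1 :> R by rewrite invf_le1 // ler1n.
have r0 : 0 <= r by rewrite subr_ge0.
have rz : cmod (r%:C * zeta) = r by rewrite cmodM zeta1 mulr1 cmod_real ger0_norm.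
have r1 : `|r%:C * zeta| < 1.
  by rewrite normE rz -realc1 ltcR ltrBlDr ltrDl.
exists (exist (fun z : R[i] => is_true (`|z| < 1)) _ r1); rewrite /stolz /= rz.
have -> : r%:C * zeta - zeta = (r - 1)%:C * zeta.
  by rewrite (realcB r 1) mulrBl realc1 mul1r.
rewrite cmodM zeta1 mulr1 cmod_real /r addrC addKr normrN ger0_norm ?ltW //; split.
  by rewrite ltf_pV2 ?posrE // ltr_nat.
by rewrite opprB addrC subrK ltr_pMl.
Qed.

Lemma stolz_nbhs_filter M : Filter (stolz_nbhs M).
Proof.
apply: filter_from_filter; first by exists 0%N.
move=> i j _ _; exists (maxn i j) => // z Sz.
by split; apply: stolzS Sz; rewrite ?leq_maxl ?leq_maxr.
Qed.

Lemma stolz_nbhs_proper M : 1 < M -> ProperFilter (stolz_nbhs M).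
Proof.
move=> M1; apply: Build_ProperFilter_ex; last exact: stolz_nbhs_filter.
by move=> A [m _ mA]; have [z Sz] := stolz_nonempty m M1; exists z; exact: mA.
Qed.

Lemma stolz_nbhs_close M (e : R) : 0 < e ->
  \forall z \near stolz_nbhs M, cmod (sval z - zeta) < e.
Proof.
move=> e0; have [N _ NP] := near_infty_natSinv_lt (PosNum e0).
by exists N => // z [zN _]; apply: lt_trans zN (NP N (leqnn N)).
Qed.

(** The nontangential filter is the intersection of the filters of fixed aperture, so limits can be
    studied one aperture at a time. *)
Lemma nt_nbhsP (A : set (disc R)) :
  nt_nbhs zeta A <-> forall M, 1 < M -> stolz_nbhs M A.
Proof.
split=> [ntA M /ntA[e e0 eA]|sA M /sA[m _ mA]].
  have [N _ NP] := near_infty_natSinv_lt (PosNum e0).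
  exists N => // z [zN zM]; apply: eA; rewrite normE ?normE.
    by rewrite ltcR; apply: lt_trans zN (NP N (leqnn N)).
  by rewrite -(realcB 1) -realcM ltcR.
exists m.+1%:R^-1; first by rewrite invr_gt0.
move=> z; rewrite !normE ltcR -(realcB 1) -realcM ltcR => zm zM.
by apply: mA; split.
Qed.

#[export] Instance nt_nbhs_filter : Filter (nt_nbhs zeta).
Proof.
split=> [|A B /nt_nbhsP sA /nt_nbhsP sB|A B AB /nt_nbhsP sA]; apply/nt_nbhsP => M M1.
- exact: (@filterT _ _ (stolz_nbhs_filter M)).
- by apply: (@filterI _ _ (stolz_nbhs_filter M)); [exact: sA|exact: sB].
- by apply: (@filterS _ _ (stolz_nbhs_filter M)) AB _; exact: sA.
Qed.

Lemma nt_cvgR (f : disc R -> R) (l : R) :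
  f @ nt_nbhs zeta --> l <->
  forall M e, 1 < M -> 0 < e -> \forall z \near stolz_nbhs M, `|f z - l| <= e.
Proof.
split=> [/cvgrPdist_le fl M e M1 e0|fl].
  have /nt_nbhsP/(_ M M1) := fl e e0.
  by apply: (@filterS _ _ (stolz_nbhs_filter M)) => z; rewrite distrC.
apply/cvgrPdist_le => e e0; apply/nt_nbhsP => M M1.
by have := fl M e M1 e0; apply: (@filterS _ _ (stolz_nbhs_filter M)) => z;
  rewrite distrC.
Qed.

Lemma nt_cvg_mx (p q : nat) (f : disc R -> 'M[R[i]]_(p, q)) (l : 'M[R[i]]_(p, q)) :
  f @ nt_nbhs zeta --> l <->
  forall M e, 1 < M -> 0 < e -> \forall z \near stolz_nbhs M,
    forall i j, cmod (f z i j - l i j) <= e.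
Proof.
split=> [/cvg_ballP fl M e M1 e0|fl].
  have e0' : 0 < e%:C :> R[i] by rewrite ltcR.
  have /nt_nbhsP/(_ M M1) := fl _ e0'.
  apply: (@filterS _ _ (stolz_nbhs_filter M)) => z [_ fz] i j.
  by have := fz i j; rewrite /ball /= normE ltcR cmod_distC => /ltW.
apply/cvg_ballP => e e0; apply/nt_nbhsP => M M1.
have e0' : 0 < complex.Re e / 2 :> R by rewrite divr_gt0 // -ltcR -ge0_ReE ?ltW.
have := fl M _ M1 e0'; apply: (@filterS _ _ (stolz_nbhs_filter M)) => z fz.
split=> // i j; rewrite /ball /= normE cmod_distC (ge0_ReE (ltW e0)) ltcR.
by apply: le_lt_trans (fz i j) _; lra.
Qed.

End StolzFilter.

(** * The reproducing kernel *)

Section Kernel.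
Variables (R : realType) (n : nat) (Theta : R[i] -> 'M[R[i]]_n).
Variables (K : set (disc R -> 'cV[R[i]]_n)).
Variable ip : (disc R -> 'cV[R[i]]_n) -> (disc R -> 'cV[R[i]]_n) -> R[i].
Hypothesis HK : is_dBR Theta K ip.

Local Notation sn := (seminorm ip).
Local Notation T z := ((Theta (sval z)) ^t*).
Local Notation d z := (delta Theta z).

Lemma dBR_semi_inner : semi_inner K ip.
Proof.
case: HK => K0 Klin iplin ipsym ipge0 _ _ _ _; split=> //.
Qed.

Lemma dBR_hilbert : hilbert K ip.
Proof.
split; first exact: dBR_semi_inner.
move=> u uK ucauchy; have [f Kf /cvgrPdist_lt uf] := rkhs_complete HK uK ucauchy.
exists f => // e e0; have [N _ NP] := uf e e0; exists N => i Ni.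
have := NP i Ni; rewrite /= sub0r normrN ger0_norm //; exact: sqrtr_ge0.
Qed.

Let Kip := dBR_semi_inner.

Lemma K_delta z x : K (d z x).
Proof. exact: (rkhs_kernel HK). Qed.

Lemma ip_delta f z x : K f -> ip f (d z x) = cdot (f z) x.
Proof. exact: (rkhs_reproducing HK). Qed.

Lemma delta_total f : K f -> (forall z x, ip f (d z x) = 0) -> f = 0.
Proof.
move=> Kf f0; apply/funext => z; apply: cdot_inj => x.
by rewrite -ip_delta // f0 (ip0l (cdot_semi_inner R n)).
Qed.

Lemma one_sub_mulCJ_neq0 (z : disc R) (w : R[i]) : cmod w <= 1 -> 1 - sval z * w^* != 0.
Proof.
move=> w1; rewrite subr_eq0; apply/eqP => /(congr1 (@cmod R)).
rewrite cmod1 cmodM cmodJ => e.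
have := disc_lt1 z; have := cmod_ge0 (sval z); have := cmod_ge0 w; nra.
Qed.

Lemma cdot_dBR_kernel w W (z : disc R) x y :
  cdot (dBR_kernel Theta w W z *m x) y =
  (1 - sval z * w^*)^-1 * (cdot x y - cdot (W ^t* *m x) (T z *m y)).
Proof.
rewrite /dBR_kernel -scalemxAl cdotZl mulmxBl mul1mx cdotBl.
by rewrite -mulmxA [cdot (Theta _ *m _) _]cdot_mulmx.
Qed.

Lemma ip_delta_delta (w z : disc R) x y : ip (d w x) (d z y) =
  (1 - sval z * (sval w)^*)^-1 * (cdot x y - cdot (T w *m x) (T z *m y)).
Proof. by rewrite ip_delta; [exact: cdot_dBR_kernel|exact: K_delta]. Qed.

Lemma ip_delta_mul (w z : disc R) x y :
  (1 - sval z * (sval w)^*) * ip (d w x) (d z y) = cdot x y - cdot (T w *m x) (T z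
    *m y).
Proof.
by rewrite ip_delta_delta mulVKf ?one_sub_mulCJ_neq0 // ltW ?disc_lt1.
Qed.

End Kernel.

(** * Boundary behaviour of kernel functions *)

Section Boundary.
Variables (R : realType) (n : nat) (V : lmodType R[i]).
Implicit Types (x y : 'cV[R[i]]_n) (z w v : disc R).

Lemma seminorm_linear_le (K : set V) ip (L : 'cV[R[i]]_n -> V) x :
  semi_inner K ip -> (forall y, K (L y)) ->
  L x = \sum_i x i 0 *: L (delta_mx i 0) ->
  seminorm ip (L x) <= (\sum_i seminorm ip (L (delta_mx i 0))) * cnorm x.
Proof.
move=> Kip KL ->; rewrite mulr_suml.
apply: le_trans (seminorm_sum Kip _ _) _ => [i|]; first exact: KZ Kip _ _ _.
apply: ler_sum => i _; rewrite (seminormZ Kip) // mulrC.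
by rewrite ler_wpM2l ?seminorm_ge0 ?cmod_coord_le.
Qed.

(* [d z x] and [T z] stand for delta_z^x and Theta(z)^*. *)
Record kernel_family (K : set V) ip (T : disc R -> 'M[R[i]]_n)
    (d : disc R -> 'cV[R[i]]_n -> V) : Prop := KernelFamily {
  kf_hilbert : hilbert K ip;
  kf_K : forall z x, K (d z x);
  kf_ip : forall w z x y, (1 - sval z * (sval w)^*) * ip (d w x) (d z y) =
    cdot x y - cdot (T w *m x) (T z *m y);
  kf_total : forall f, K f -> (forall z x, ip f (d z x) = 0) -> f = 0 }.

(* [db x] stands for delta_zeta^x, with [U] for Theta(zeta). *)
Record boundary_kernel (K : set V) ip (T : disc R -> 'M[R[i]]_n)
    (d : disc R -> 'cV[R[i]]_n -> V) (zeta : R[i]) (U : 'M[R[i]]_n)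
    (db : 'cV[R[i]]_n -> V) : Prop := BoundaryKernel {
  bk_zeta : cmod zeta = 1;
  bk_unitary : U \is unitarymx;
  bk_K : forall x, K (db x);
  bk_ip : forall z x y, (1 - sval z * zeta^*) * ip (db x) (d z y) =
    cdot x y - cdot (U ^t* *m x) (T z *m y);
  bk_bounded : exists2 C : R, 0 <= C & forall x, seminorm ip (db x) <= C * cnorm x }.

Variables (K : set V) (ip : V -> V -> R[i]) (T : disc R -> 'M[R[i]]_n).
Variables (d : disc R -> 'cV[R[i]]_n -> V).
Hypothesis Hd : kernel_family K ip T d.
Local Notation sn := (seminorm ip).
Let HK := kf_hilbert Hd.
Let Kip := hilbert_semi_inner HK.
Let Kd := kf_K Hd.

Lemma kf_seminorm z x :
  (1 - cmod (sval z) ^+ 2) * sn (d z x) ^+ 2 = cnorm x ^+ 2 - cnorm (T z *m x) ^+ 2.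
Proof.
apply: (@complexI R); rewrite realcM !realcB -!cnorm_sqr realc1 -mulcJ.
by rewrite -(seminorm_sqr Kip (Kd z x)) (kf_ip Hd).
Qed.

Lemma kf_contractive z x : cnorm (T z *m x) <= cnorm x.
Proof.
rewrite -(@ler_pXn2r _ 2) ?nnegrE ?cnorm_ge0 // -subr_ge0 -kf_seminorm.
by rewrite mulr_ge0 ?sqr_ge0 // subr_ge0 exprn_ile1 ?cmod_ge0 // ltW ?disc_lt1.
Qed.

Lemma kf_defect_ge z : 1 - cmod (sval z) <= 1 - cmod (sval z) ^+ 2.
Proof. by have := disc_lt1 z; have := cmod_ge0 (sval z); nra. Qed.

(* Multiplying the kernel by [1 - z w^*] leaves [1 - Theta(z) Theta(w)^*],
   whose second difference is nonpositive. *)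
Lemma kf_lipschitz z w x :
  sn (d w x - d z x) <= cmod (sval w - sval z) * sn (d z x) / (1 - cmod (sval w)).
Proof.
have [Kw Kz] := (Kd w x, Kd z x).
apply: (seminorm_shift_le Kip) => //; first exact: disc_lt1.
have Kwz := KB Kip Kw Kz.
have Kab := KB Kip (KZ Kip (sval w)^* Kw) (KZ Kip (sval z)^* Kz).
have E : ip (d w x - d z x) (d w x - d z x) -
   ip ((sval w)^* *: d w x - (sval z)^* *: d z x) ((sval w)^* *: d w x - (sval z)^*
     *: d z x) =
    - cdot (T w *m x - T z *m x) (T w *m x - T z *m x).
  rewrite (ip_shift_defect Kip) //.
  rewrite !(kf_ip Hd) cdotBl !cdotBr.
  move: (cdot x x) (cdot (T w *m x) _) (cdot (T w *m x) _) (cdot (T z *m x) _)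
    (cdot (T z *m x) _).
  by move=> p q r s t; ring.
rewrite -(@ler_pXn2r _ 2) ?nnegrE ?seminorm_ge0 //.
have := congr1 (@complex.Re R) E.
rewrite ReD !ReN (Re_ip_self Kip Kwz) (Re_ip_self Kip Kab) cnorm_sqr /= => E'.
by rewrite -subr_le0 E' oppr_le0 sqr_ge0.
Qed.

(** The vectors [d z y] are bounded and converge against each [d w x], so [weak_limit] applies. As
    the limit is described by the kernel relation at [zeta], the lemma serves both to construct
    delta_zeta and to prove weak convergence to it. *)
Lemma kf_weak_limit (zeta : R[i]) (U : 'M[R[i]]_n) (S : nat -> set (disc R)) (B : R) y :
  cmod zeta = 1 -> (forall m, S m.+1 `<=` S m) -> (forall m, S m !=set0) ->
  (forall z, S 0%N z -> sn (d z y) <= B) ->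
  (forall e : R, 0 < e -> exists m, forall z, S m z -> cmod (sval z - zeta) <= e) ->
  (forall e : R, 0 < e -> exists m, forall z, S m z -> cnorm (T z *m y - U ^t* *m
    y) <= e) ->
  exists g, [/\ K g,
    forall w x, (1 - sval w * zeta^*) * ip g (d w x) =
      cdot y x - cdot (U ^t* *m y) (T w *m x) &
    forall h (e : R), K h -> 0 < e ->
      exists m, forall z, S m z -> cmod (ip (d z y) h - ip g h) <= e].
Proof.
move=> zeta1 Ssub Sn0 SB Szeta SU.
have Smono := nested_subset Ssub.
pose F m := [set d z y | z in S m].
pose D (j : disc R * 'cV[R[i]]_n) := d j.1 j.2.
pose l (j : disc R * 'cV[R[i]]_n) := (1 - sval j.1 * zeta^*)^-1 *
  (cdot y j.2 - cdot (U ^t* *m y) (T j.1 *m j.2)).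
have c_neq0 w : 1 - sval w * zeta^* != 0 by rewrite one_sub_mulCJ_neq0 ?zeta1.
have [||f|j|f Kf f0|j e e0|g [Kg gD gw]] := @weak_limit _ _ _ _ HK F B _ D l.
- by move=> m _ [z Sz <-]; exists z => //; exact: Ssub.
- by move=> m; have [z Sz] := Sn0 m; exists (d z y), z.
- by case=> z Sz <-; split; [exact: Kd|exact: SB].
- exact: Kd.
- by apply: (kf_total Hd Kf) => z x; exact: f0 (z, x).
- case: j => w x; rewrite /D /l /=; set c := 1 - _.
  have c0 : 0 < cmod c by rewrite cmod_gt0 c_neq0.
  have x1 : 0 < cnorm x + 1 by rewrite ltr_wpDl ?cnorm_ge0.
  have N1 : 0 < `|B| * sn (d w x) + 1 by rewrite ltr_wpDl ?mulr_ge0 ?seminorm_ge0.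
  (* After multiplication by [c], each of two errors may use half of [e * cmod c]. *)
  have ec0 : 0 < e * cmod c / 2 by rewrite divr_gt0 ?mulr_gt0.
  have [m1 S1] := SU _ (divr_gt0 ec0 x1); have [m2 S2] := Szeta _ (divr_gt0 ec0 N1).
  exists (maxn m1 m2) => _ [z Sz <-].
  have := S1 z (Smono _ _ (leq_maxl _ _) _ Sz);
    have := S2 z (Smono _ _ (leq_maxr _ _) _ Sz).
  rewrite !ler_pdivlMr // => rz ez.
  set p := ip (d z y) (d w x).
  have p_le : cmod p <= `|B| * sn (d w x).
    apply: le_trans (cauchy_schwarz Kip (Kd z y) (Kd w x)) _.
    rewrite ler_wpM2r ?seminorm_ge0 // (le_trans _ (ler_norm _)) // SB //.
    exact: Smono (leq0n _) _ Sz.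
  (* One error comes from [T z] in place of [U ^t*], the other from [z] in place of [zeta] in the
     factor of the kernel relation. *)
  have E : c * (p - c^-1 * (cdot y x - cdot (U ^t* *m y) (T w *m x))) =
      - cdot (T z *m y - U ^t* *m y) (T w *m x) + sval w * (sval z - zeta)^* * p.
    rewrite mulrBr mulVKf ?c_neq0 //.
    have -> : c * p = (1 - sval w * (sval z)^*) * p + sval w * (sval z - zeta)^* * p.
      by rewrite rmorphB /= /c; ring.
    rewrite (kf_ip Hd) cdotBl.
    move: (cdot y x) (cdot (T z *m y) _) (cdot (U ^t* *m y) _) => a1 a2 a3; ring.
  rewrite -(ler_pM2l c0) -cmodM E.
  apply: le_trans (cmodD _ _) _; rewrite cmodN !cmodM cmodJ.
  have h1 := le_trans (cdot_cs (T z *m y - U ^t* *m y) (T w *m x))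
    (ler_wpM2l (cnorm_ge0 _) (kf_contractive w x)).
  have := disc_lt1 w; have := cmod_ge0 (sval w); have := cmod_ge0 (sval z - zeta).
  have := cnorm_ge0 (T z *m y - U ^t* *m y); have := cmod_ge0 p;
    have := seminorm_ge0 ip (d w x).
  move: h1 rz ez p_le; set q := cmod (cdot _ _).
  move: (cmod p) (cnorm (_ - _)) (cmod (sval w)) (cmod (sval z - zeta)) (sn _)
    (cnorm x) (cmod c) (`|B|).
  move=> P N a r s N' c' B' h1 rz ez p_le s0 P0 N0 r0 a0 a1.
  move=> {e0 c0 x1 N1 ec0}.
  have h2 : a * r * P <= r * (B' * s + 1).
    have : a * r <= r by nra.
    by nra.
  have h3 : N * N' <= N * (N' + 1) by nra.
  lra.
exists g; split=> // [w x|h e Kh e0].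
  by have /= -> := gD (w, x); rewrite /l mulVKf.
have [m Fm] := gw h e Kh e0; exists m => z Sz; apply: Fm; exists z => //.
Qed.

Variables (zeta : R[i]) (U : 'M[R[i]]_n) (db : 'cV[R[i]]_n -> V).

(** * Convergence of the kernel functions in Stolz regions *)

Section Limits.
Hypothesis Hb : boundary_kernel K ip T d zeta U db.
Let zeta1 := bk_zeta Hb.
Let Uu := bk_unitary Hb.
Let Kdb := bk_K Hb.
Local Notation W := (U ^t*).
Local Notation rho z := (cmod (sval z - zeta)).

Lemma cmod_one_sub z : cmod (1 - sval z * zeta^*) = rho z.
Proof.
have -> : 1 - sval z * zeta^* = (zeta - sval z) * zeta^*.
  by rewrite mulrBl mulcJ zeta1 expr1n realc1.
by rewrite cmodM cmodJ zeta1 mulr1 cmod_distC.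
Qed.

Lemma one_sub_cmod_le z : 1 - cmod (sval z) <= rho z.
Proof.
rewrite lerBlDr -zeta1 -[X in cmod X](subrK (sval z)) (le_trans (cmodD _ _)) //.
by rewrite cmod_distC.
Qed.

Lemma bk_ip_sub z x y :
  (1 - sval z * zeta^*) * ip (db x) (d z y) = - cdot (W *m x) (T z *m y - W *m y).
Proof. by rewrite (bk_ip Hb) cdotBr unitary_isometry // opprB. Qed.

(** Test with [x = U *m e], which [W] sends back to [e]. *)
Lemma cnorm_unitary_le (e : 'cV[R[i]]_n) (c : R) :
  0 <= c -> (forall x, cmod (cdot (W *m x) e) <= c * cnorm x) -> cnorm e <= c.
Proof.
move=> c0 /(_ (U *m e)); rewrite mulmxA unitary_mulCmx // mul1mx cnorm_sqr cmod_real.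
rewrite ger0_norm ?sqr_ge0 //.
have -> : cnorm (U *m e) = cnorm e.
  rewrite -[in RHS](mul1mx e) -(unitary_mulCmx Uu) -mulmxA.
  by rewrite unitary_cnorm.
rewrite expr2; have [->//|e_neq0] := eqVneq (cnorm e) 0.
by rewrite ler_pM2r // lt_def e_neq0 cnorm_ge0.
Qed.

Lemma bk_defect C : 0 <= C -> (forall x, sn (db x) <= C * cnorm x) ->
  forall z y, cnorm (T z *m y - W *m y) <= C * rho z * sn (d z y).
Proof.
move=> C0 dbC z y; apply: cnorm_unitary_le => [|x].
  by rewrite !mulr_ge0 ?cmod_ge0 ?seminorm_ge0.
rewrite -cmodN -bk_ip_sub cmodM cmod_one_sub.
have := cauchy_schwarz Kip (Kdb x) (Kd z y) => CS.
have -> : C * rho z * sn (d z y) * cnorm x = rho z * (C * cnorm x * sn (d z y)) by ring.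
rewrite ler_wpM2l ?cmod_ge0 // (le_trans CS) // ler_wpM2r ?seminorm_ge0 //.
Qed.

(** Let [N = sn (d z y)], [s = 1 - |z|^2] and [e = |T z y - W y|]. As [W] is isometric, [s N^2] is
    at most [2 |y| e], while [bk_defect] and the Stolz condition give [e <= C M s N]. Both [s] and
    one factor [N] cancel. *)
Lemma bk_bound C : 0 <= C -> (forall x, sn (db x) <= C * cnorm x) ->
  forall M m z y, stolz zeta M m z -> sn (d z y) <= 2 * C * M * cnorm y.
Proof.
move=> C0 dbC M m z y [_ zM].
have e_le := bk_defect C0 dbC z y; set e := cnorm _ in e_le.
have z1 := disc_lt1 z; have s_ge := kf_defect_ge z.
have Ty : cnorm y <= cnorm (T z *m y) + e.
  have -> : e = cnorm (W *m y - T z *m y) by rewrite -opprB cnormN.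
  rewrite -[X in X <= _](unitary_cnorm y Uu).
  by apply: le_trans (cnormD _ _); rewrite addrCA subrr addr0.
have Ty' := kf_contractive z y.
have := kf_seminorm z y.
set t := cnorm (T z *m y) in Ty Ty' *; set N := sn (d z y) in e_le *.
set s := 1 - _ ^+ 2 in s_ge *; have y0 := cnorm_ge0 y; have t0 := cnorm_ge0 (T z *m y).
have N0 : 0 <= N := seminorm_ge0 _ _; have r0 := cmod_ge0 (sval z - zeta).
rewrite -/t in t0 *; move=> sN.
have M0 : 0 < M by have := le_lt_trans r0 zM; rewrite pmulr_lgt0 // subr_gt0.
have s0 : 0 < s by apply: lt_le_trans s_ge; rewrite subr_gt0.
have h1 : s * N ^+ 2 <= 2 * cnorm y * e.
  rewrite sN subr_sqr; have : 0 <= e := cnorm_ge0 _.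
  move=> {M0 s0 e_le s_ge zM N0 r0 sN}.
  have : cnorm y - t <= e by lra.
  have : 0 <= cnorm y + t <= 2 * cnorm y by apply/andP; split; lra.
  have : 0 <= cnorm y - t by lra.
  by move=> ? /andP[? ?] ? ?; nra.
have h2 : e <= C * (M * s) * N.
  apply: le_trans e_le _; rewrite ler_wpM2r // ler_wpM2l //.
  by apply: le_trans (ltW zM) _; rewrite ler_pM2l.
have h3 : s * (N * N) <= s * (2 * C * M * cnorm y * N).
  have : 2 * cnorm y * e <= 2 * cnorm y * (C * (M * s) * N) by rewrite ler_wpM2l
    ?mulr_ge0.
  by rewrite expr2 in h1; move=> h; apply: le_trans (le_trans h1 h) _;
    rewrite le_eqVlt; apply/orP; left; apply/eqP; ring.
rewrite ler_pM2l // in h3.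
have [->|N_neq0] := eqVneq N 0; first by rewrite !mulr_ge0 // ltW.
by rewrite ler_pM2r // lt_def N_neq0 in h3.
Qed.

Lemma near_linear_small M (f : disc R -> R) (c : R) :
  (forall z, stolz zeta M 0%N z -> f z <= c * rho z) ->
  forall e, 0 < e -> \forall z \near stolz_nbhs zeta M, f z <= e.
Proof.
move=> fc e e0; have F := stolz_nbhs_filter zeta M.
have c1 : 0 < `|c| + 1 by rewrite ltr_wpDl.
have := stolz_nbhs_close zeta M (divr_gt0 e0 c1).
have S0 : stolz_nbhs zeta M (stolz zeta M 0%N) by exists 0%N.
apply: filterS2 S0 => z /fc fz; rewrite ltr_pdivlMr // => rz.
have := cmod_ge0 (sval z - zeta); have := ler_norm c; nra.
Qed.

Lemma bk_adjoint_cvg M e : 1 < M -> 0 < e -> \forall z \near stolz_nbhs zeta M,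
  forall y, cnorm (T z *m y - W *m y) <= e * cnorm y.
Proof.
move=> M1 e0; have F := stolz_nbhs_filter zeta M.
have [C C0 dbC] := bk_bounded Hb.
have S0 : stolz_nbhs zeta M (stolz zeta M 0%N) by exists 0%N.
have := @near_linear_small M (fun z => C * rho z * (2 * C * M)) (C * (2 * C * M)).
move=> /(_ _ e e0); have h : forall z, stolz zeta M 0%N z ->
    C * rho z * (2 * C * M) <= C * (2 * C * M) * rho z.
  by move=> z _; rewrite mulrAC.
move=> /(_ h); apply: filterS2 S0 => z Sz ze y.
apply: le_trans (bk_defect C0 dbC z y) _.
apply: le_trans (_ : C * rho z * (2 * C * M) * cnorm y <= _); last first.
  by rewrite ler_wpM2r ?cnorm_ge0.
rewrite -[X in _ <= X]mulrA ler_wpM2l ?mulr_ge0 ?cmod_ge0 //.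
exact: bk_bound Sz.
Qed.

(** The weak limit given by [kf_weak_limit] satisfies the relation that defines [db y], and totality
    identifies the two. *)
Lemma bk_weak_cvg M y h e : 1 < M -> K h -> 0 < e ->
  \forall z \near stolz_nbhs zeta M, cmod (ip (d z y) h - ip (db y) h) <= e.
Proof.
move=> M1 Kh e0; have [C C0 dbC] := bk_bounded Hb.
have [|||e' e'0|e' e'0|g [Kg gD gw]] := @kf_weak_limit zeta U (stolz zeta M)
    (2 * C * M * cnorm y) y zeta1.
- by move=> m; exact: stolzS.
- by move=> m; exact: stolz_nonempty.
- by move=> z; exact: bk_bound.
- by have [m _ Sm] := stolz_nbhs_close zeta M e'0; exists m => z /Sm /ltW.
- have y1 : 0 < cnorm y + 1 by rewrite ltr_wpDl ?cnorm_ge0.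
  have [m _ Sm] := bk_adjoint_cvg M1 (divr_gt0 e'0 y1); exists m => z /Sm/(_ y) h1.
  apply: le_trans h1 _; rewrite mulrAC ler_pdivrMr // ler_pM2l //; lra.
have <- : g = db y.
  apply/eqP; rewrite -subr_eq0; apply/eqP/(kf_total Hd).
    exact: KB Kip _ _ _ _.
  move=> w x; rewrite (ipBl Kip) //.
  have c0 : 1 - sval w * zeta^* != 0 by rewrite one_sub_mulCJ_neq0 ?zeta1.
  by apply: (mulfI c0); rewrite mulrBr gD (bk_ip Hb) mulr0 subrr.
by have [m Sm] := gw h e Kh e0; exists m.
Qed.

Lemma bk_weak_cvg_r M y h e : 1 < M -> K h -> 0 < e ->
  \forall z \near stolz_nbhs zeta M, cmod (ip h (d z y) - ip h (db y)) <= e.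
Proof.
move=> M1 Kh e0; have F := stolz_nbhs_filter zeta M.
apply: filterS (bk_weak_cvg y M1 Kh e0) => z.
by rewrite (ip_sym Kip Kh (Kd z y)) (ip_sym Kip Kh (Kdb y)) -rmorphB cmodJ.
Qed.

(** This trades the factor [1 - |z|^2] of the kernel relation at two interior points for the factor
    [1 - z zeta^*] of the boundary relation, up to second order in [rho z]. *)
Lemma defect_sum z : (1 - sval z * zeta^*) + (1 - sval z * zeta^*)^* =
  (1 - cmod (sval z) ^+ 2 + rho z ^+ 2)%:C.
Proof.
rewrite -cmod_one_sub realcD realcB -!mulcJ realc1 !rmorphB !rmorphM /= conjCK rmorph1.
have : zeta * zeta^* = 1 by rewrite mulcJ zeta1 expr1n.
move: (sval z) => t zz.
transitivity (1 - t * t^* + (1 - t * zeta^* - t^* * zeta + t * t^* * (zeta * zeta^*))).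
  by rewrite zz; ring.
by ring.
Qed.

(** After multiplication by [s = 1 - |z|^2], the error consists of weak errors [p - a], [q - a] with
    coefficients of modulus [rho z <= M s], and of terms of order [rho z ^+ 2]. Both are [s] times
    something small. *)
Lemma bk_gram_cvg M x y e : 1 < M -> 0 < e ->
  \forall z \near stolz_nbhs zeta M,
    cmod (ip (d z x) (d z y) - ip (db x) (db y)) <= e.
Proof.
move=> M1 e0; have F := stolz_nbhs_filter zeta M.
have M0 : 0 < M by lra.
have [C C0 dbC] := bk_bounded Hb.
set a := ip (db x) (db y).
(* Gathers the second-order terms: one factor [rho z] is replaced by [M * s], leaving
   [s * (rho z * c4)]. *)
pose c4 := C * (2 * C * M * cnorm x) * (C * (2 * C * M * cnorm y)) * M + M * cmod a.
have c4_ge0 : 0 <= c4.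
  by rewrite /c4 addr_ge0 // !mulr_ge0 ?cnorm_ge0 ?cmod_ge0 // ltW.
have e1 : 0 < e / (4 * M) by rewrite divr_gt0 ?mulr_gt0.
have e2 : 0 < e / (2 * (c4 + 1)) by rewrite divr_gt0 ?mulr_gt0 // ltr_wpDl.
have H1 := bk_weak_cvg_r y M1 (Kdb x) e1.
have H2 := bk_weak_cvg x M1 (Kdb y) e1.
have H3 := stolz_nbhs_close zeta M e2.
have S0 : stolz_nbhs zeta M (stolz zeta M 0%N) by exists 0%N.
apply: filterS3 (filterI H1 H2) H3 S0 => z [/= pz qz] rz Sz.
set p := ip (db x) (d z y) in pz; set q := ip (d z x) (db y) in qz.
rewrite -/a in pz qz; set c := 1 - sval z * zeta^*.
set s : R := 1 - cmod (sval z) ^+ 2.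
have s_gt0 : 0 < s by apply: lt_le_trans (kf_defect_ge z); rewrite subr_gt0 disc_lt1.
have rs : rho z <= M * s.
  by case: Sz => _ /ltW /le_trans; apply; rewrite ler_pM2l // kf_defect_ge.
have cp : c * p = - cdot (W *m x) (T z *m y - W *m y) := bk_ip_sub z x y.
have cq : c^* * q = - cdot (T z *m x - W *m x) (W *m y).
  rewrite /q (ip_sym Kip (Kdb y) (Kd z x)) -rmorphM bk_ip_sub rmorphN.
  by rewrite (cdotC (W *m y)).
have E : s%:C * (ip (d z x) (d z y) - a) =
   (rho z ^+ 2)%:C * a + c * (p - a) + c^* * (q - a)
   - cdot (T z *m x - W *m x) (T z *m y - W *m y).
  have -> : s%:C * (ip (d z x) (d z y) - a) = s%:C * ip (d z x) (d z y) - s%:C * a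
    by rewrite mulrBr.
  have -> : s%:C * ip (d z x) (d z y) = cdot x y - cdot (T z *m x) (T z *m y).
    by rewrite -(kf_ip Hd) mulcJ -(realcB 1).
  have -> : s%:C * a = (c + c^*) * a - (rho z ^+ 2)%:C * a.
    by rewrite defect_sum (realcD s) -mulrBl addrK.
  rewrite !mulrBr cp cq !(cdotBl, cdotBr) -(unitary_isometry x y Uu).
  move: (cdot (W *m x) (W *m y)) (cdot (T z *m x) (T z *m y)) (cdot (W *m x) (T z
    *m y)) (cdot (T z *m x) (W *m y)) => a1 a2 a3 a4; ring.
have sC : cmod s%:C = s by rewrite cmod_real gtr0_norm.
rewrite -(ler_pM2l s_gt0) -{1}sC -cmodM E.
have cE : cmod c = rho z := cmod_one_sub z.
apply: le_trans (cmodB _ _) _; apply: le_trans (lerD (cmodD _ _) (lexx _)) _.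
apply: le_trans (lerD (lerD (cmodD _ _) (lexx _)) (lexx _)) _.
rewrite !cmodM cmod_real ger0_norm ?sqr_ge0 // cmodJ cE.
have ez := cdot_cs (T z *m x - W *m x) (T z *m y - W *m y).
have ex : cnorm (T z *m x - W *m x) <= rho z * (C * (2 * C * M * cnorm x)).
  apply: le_trans (bk_defect C0 dbC z x) _.
  by rewrite (mulrC C) -(mulrA (rho z)) ler_wpM2l ?cmod_ge0 // ler_wpM2l //
    (bk_bound C0 dbC _ Sz).
have ey : cnorm (T z *m y - W *m y) <= rho z * (C * (2 * C * M * cnorm y)).
  apply: le_trans (bk_defect C0 dbC z y) _.
  by rewrite (mulrC C) -(mulrA (rho z)) ler_wpM2l ?cmod_ge0 // ler_wpM2l //
    (bk_bound C0 dbC _ Sz).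
have {ez ex ey} ez : cmod (cdot (T z *m x - W *m x) (T z *m y - W *m y)) <=
    rho z * (C * (2 * C * M * cnorm x)) * (rho z * (C * (2 * C * M * cnorm y))).
  by apply: le_trans ez _; rewrite ler_pM ?cnorm_ge0.
have r0 := cmod_ge0 (sval z - zeta).
have t1 : rho z ^+ 2 * cmod a + cmod (cdot (T z *m x - W *m x) (T z *m y - W *m y))
  <= s * (rho z * c4).
  apply: le_trans (lerD (lexx _) ez) _.
  have -> : rho z ^+ 2 * cmod a + rho z * (C * (2 * C * M * cnorm x)) * (rho z * (C
    * (2 * C * M * cnorm y)))
    = rho z * (rho z * (cmod a + C * (2 * C * M * cnorm x) * (C * (2 * C * M *
      cnorm y)))) by ring.
  have -> : s * (rho z * c4) = rho z * (M * s * (cmod a + C * (2 * C * M * cnorm x)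
    * (C * (2 * C * M * cnorm y)))).
    by rewrite /c4; ring.
  rewrite ler_wpM2l // ler_wpM2r // addr_ge0 ?cmod_ge0 //.
  by rewrite !mulr_ge0 ?cnorm_ge0 // ltW.
have t2 : s * (rho z * c4) <= s * (e / 2).
  rewrite ler_pM2l //; rewrite ltr_pdivlMr in rz; last by rewrite mulr_gt0 // ltr_wpDl.
  by move=> {M1 M0 C0 e1 e2 pz qz rs ez t1 cp cq E sC cE}; nra.
have t3 u : u <= e / (4 * M) -> 0 <= u -> rho z * u <= s * (e / 4).
  move=> ue u0; apply: le_trans (_ : M * s * (e / (4 * M)) <= _);
    first by rewrite ler_pM.
  by rewrite le_eqVlt; apply/orP; left; apply/eqP; field; rewrite gt_eqF.
have := t3 _ pz (cmod_ge0 _); have := t3 _ qz (cmod_ge0 _).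
by move=> tq tp {M1 M0 e0 C0 c4_ge0 e1 e2 pz qz rz s_gt0 rs ez r0 cp cq E sC cE}; lra.
Qed.

(** Weak convergence together with convergence of the norms, the diagonal case of [bk_gram_cvg]. *)
Lemma bk_norm_cvg M x e : 1 < M -> 0 < e ->
  \forall z \near stolz_nbhs zeta M, sn (d z x - db x) <= e.
Proof.
move=> M1 e0; have F := stolz_nbhs_filter zeta M.
have e2 : 0 < e ^+ 2 / 4 by rewrite divr_gt0 ?exprn_gt0.
have H1 := bk_gram_cvg x x M1 e2; have H2 := bk_weak_cvg x M1 (Kdb x) e2.
apply: filterS2 H1 H2 => z h1 h2.
rewrite -(@ler_pXn2r _ 2) ?nnegrE ?seminorm_ge0 // ?ltW //.
rewrite (seminormB_sqr Kip) // -!(Re_ip_self Kip) //.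
have h3 := le_trans (le_trans (ler_norm _) (Re_le_cmod _)) h1.
rewrite cmod_distC in h2; have h4 := le_trans (le_trans (ler_norm _) (Re_le_cmod _)) h2.
by rewrite !ReD !ReN in h3 h4; lra.
Qed.

(** * Increments of the kernel functions and of the adjoint *)

Lemma disc_half z w : cmod (sval w - sval z) <= (1 - cmod (sval z)) / 2 ->
  (1 - cmod (sval z)) / 2 <= 1 - cmod (sval w).
Proof.
move=> wz; have := cmodD (sval w - sval z) (sval z).
by rewrite subrK; lra.
Qed.

Lemma kf_increment f z w y : K f ->
  cmod (sval w - sval z) <= (1 - cmod (sval z)) / 2 ->
  cmod (ip f (d w y - d z y)) <=
    sn f * (2 * cmod (sval w - sval z) * sn (d z y) / (1 - cmod (sval z))).
Proof.
move=> Kf wz; have Kwz := KB Kip (Kd w y) (Kd z y).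
apply: le_trans (cauchy_schwarz Kip Kf Kwz) _; rewrite ler_wpM2l ?seminorm_ge0 //.
apply: le_trans (kf_lipschitz z w y) _; have z0 : 0 < 1 - cmod (sval z).
  by rewrite subr_gt0 disc_lt1.
have w0 : 0 < 1 - cmod (sval w) by rewrite subr_gt0 disc_lt1.
have -> : 2 * cmod (sval w - sval z) * sn (d z y) / (1 - cmod (sval z)) =
  cmod (sval w - sval z) * sn (d z y) * ((1 - cmod (sval z)) / 2)^-1.
  by field; rewrite gt_eqF.
rewrite ler_wpM2l ?mulr_ge0 ?cmod_ge0 ?seminorm_ge0 //.
by rewrite lef_pV2 ?posrE ?divr_gt0 // disc_half.
Qed.

(** The difference of [bk_ip] at [z] and [w]. The first term yields the derivative; the second is
    the error to be controlled. *)
Lemma bk_increment z w x y :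
  cdot (W *m x) (T w *m y - T z *m y) =
  (sval w - sval z) * zeta^* * ip (db x) (d z y)
  - (1 - sval w * zeta^*) * ip (db x) (d w y - d z y).
Proof.
rewrite (ipBr Kip) // mulrBr (bk_ip Hb) cdotBr.
have -> : (sval w - sval z) * zeta^* * ip (db x) (d z y) =
  (1 - sval z * zeta^*) * ip (db x) (d z y) - (1 - sval w * zeta^*) * ip (db x) (d
    z y) by ring.
rewrite (bk_ip Hb).
move: (cdot x y) (cdot (W *m x) _) (cdot (W *m x) _) (_ * ip _ _) => a1 a2 a3 a4; ring.
Qed.

Lemma cmod_one_sub_near z w : cmod (sval w - sval z) <= (1 - cmod (sval z)) / 2 ->
  cmod (1 - sval w * zeta^*) <= 2 * rho z.
Proof.
move=> wz; have -> : 1 - sval w * zeta^* = (1 - sval z * zeta^*) - (sval w - sval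
  z) * zeta^* by ring.
apply: le_trans (cmodB _ _) _; rewrite cmod_one_sub cmodM cmodJ zeta1 mulr1.
by have := one_sub_cmod_le z; have := cmod_ge0 (sval z - zeta); lra.
Qed.

(** The factor [1 - w zeta^*] is at most [2 M (1 - |z|)] in modulus and cancels the denominator in
    [kf_increment], so the constant does not blow up as [z] tends to [zeta]. *)
Lemma bk_adjoint_lipschitz C M m z w y : 0 <= C -> (forall x, sn (db x) <= C *
  cnorm x) ->
  stolz zeta M m z -> cmod (sval w - sval z) <= (1 - cmod (sval z)) / 2 ->
  cnorm (T w *m y - T z *m y) <=
    C * (2 * C * M * cnorm y) * (1 + 4 * M) * cmod (sval w - sval z).
Proof.
move=> C0 dbC Sz wz; have N_le := bk_bound C0 dbC y Sz.
have z0 : 0 < 1 - cmod (sval z) by rewrite subr_gt0 disc_lt1.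
have zV0 : 0 <= (1 - cmod (sval z))^-1 by rewrite invr_ge0 ltW.
case: (Sz) => _ rM.
have M0 : 0 < M by have := le_lt_trans (cmod_ge0 _) rM; rewrite pmulr_lgt0.
set N := 2 * C * M * cnorm y in N_le *.
have N0 : 0 <= N by apply: le_trans N_le; exact: seminorm_ge0.
set h := cmod (sval w - sval z) in wz *; have h0 : 0 <= h := cmod_ge0 _.
have M14 : 0 <= 1 + 4 * M by lra.
apply: cnorm_unitary_le => [|x];
  first exact: mulr_ge0 (mulr_ge0 (mulr_ge0 C0 N0) M14) h0.
rewrite bk_increment; apply: le_trans (cmodB _ _) _;
  rewrite !cmodM cmodJ zeta1 mulr1 -/h.
have x0 := cnorm_ge0 x.
have q1 : cmod (ip (db x) (d z y)) <= C * cnorm x * N.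
  by apply: le_trans (cauchy_schwarz Kip (Kdb x) (Kd z y)) _;
    rewrite ler_pM ?seminorm_ge0.
have q2 : cmod (ip (db x) (d w y - d z y)) <= C * cnorm x * (2 * h * N / (1 - cmod
  (sval z))).
  apply: le_trans (kf_increment y (Kdb x) wz) _; rewrite -/h ler_pM ?seminorm_ge0 //.
    by rewrite !mulr_ge0 ?invr_ge0 ?seminorm_ge0 // ltW.
  by apply: ler_wpM2r => //; apply: ler_wpM2l => //; exact: mulr_ge0.
have q3 : cmod (1 - sval w * zeta^*) <= 2 * (M * (1 - cmod (sval z))).
  by apply: le_trans (cmod_one_sub_near wz) _; rewrite ler_pM2l // ltW.
have -> : C * N * (1 + 4 * M) * h * cnorm x = h * (C * cnorm x * N) +
    2 * (M * (1 - cmod (sval z))) * (C * cnorm x * (2 * h * N / (1 - cmod (sval z)))).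
  by field; rewrite gt_eqF.
apply: lerD; first exact: ler_wpM2l.
by apply: ler_pM => //; exact: cmod_ge0.
Qed.

(** For fixed [v] the factor [1 - w v^*] stays away from 0, so a Lipschitz bound for [T] passes to
    the pairing with [d v x], uniformly up to the boundary. *)
Lemma kf_pointwise_lipschitz v z w x y L :
  cnorm (T w *m y - T z *m y) <= L * cmod (sval w - sval z) ->
  (1 - cmod (sval v)) * cmod (ip (d v x) (d w y - d z y)) <=
    (sn (d v x) * sn (d z y) + cnorm x * L) * cmod (sval w - sval z).
Proof.
move=> TL; have E : (1 - sval w * (sval v)^*) * ip (d v x) (d w y - d z y) =
    (sval w - sval z) * (sval v)^* * ip (d v x) (d z y) - cdot (T v *m x) (T w *m y
      - T z *m y).
  rewrite (ipBr Kip) // mulrBr (kf_ip Hd) cdotBr.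
  have -> : (sval w - sval z) * (sval v)^* * ip (d v x) (d z y) =
    (1 - sval z * (sval v)^*) * ip (d v x) (d z y) - (1 - sval w * (sval v)^*) * ip
      (d v x) (d z y) by ring.
  rewrite (kf_ip Hd).
  move: (cdot x y) (cdot (T v *m x) _) (cdot (T v *m x) _) (_ * ip _ _) => a1 a2 a3
    a4; ring.
have v1 := disc_lt1 v; have w1 := disc_lt1 w.
have c_ge : 1 - cmod (sval v) <= cmod (1 - sval w * (sval v)^*).
  have := cmodD (1 - sval w * (sval v)^*) (sval w * (sval v)^*).
  rewrite subrK cmod1 cmodM cmodJ => h.
  by have := cmod_ge0 (sval v); have := cmod_ge0 (sval w); nra.
apply: le_trans (ler_wpM2r (cmod_ge0 _) c_ge) _.
rewrite -cmodM E; apply: le_trans (cmodB _ _) _; rewrite !cmodM cmodJ mulrDl.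
have h0 := cmod_ge0 (sval w - sval z).
apply: lerD; last first.
  apply: le_trans (cdot_cs _ _) _; rewrite -mulrA ler_pM ?cnorm_ge0 //.
  exact: kf_contractive.
rewrite [leRHS]mulrC ler_pM ?mulr_ge0 ?cmod_ge0 //; last exact: (cauchy_schwarz Kip).
by rewrite -[leRHS]mulr1 ler_wpM2l // ltW.
Qed.

(* On replacing [db x] by a nearby [d v x] with [v] fixed, whose inner product
   with [d w y - d z y] is [O(w - z)], the error term
   [(1 - w zeta^* ) <db x, d w y - d z y>] of [bk_increment] becomes small. *)
Lemma bk_derivative M x y e : 1 < M -> 0 < e -> \forall z \near stolz_nbhs zeta M,
  forall w, cmod (sval w - sval z) <= (1 - cmod (sval z)) / 2 ->
  cmod (cdot (W *m x) (T w *m y - T z *m y)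
        - (sval w - sval z) * zeta^* * ip (db x) (db y))
    <= e * cmod (sval w - sval z).
Proof.
move=> M1 e0; have F := stolz_nbhs_filter zeta M; have M0 : 0 < M by lra.
have [C C0 dbC] := bk_bounded Hb.
pose N := 2 * C * M * cnorm y; have N0 : 0 <= N by rewrite !mulr_ge0 ?cnorm_ge0 // ltW.
have e3 : 0 < e / 3 by rewrite divr_gt0.
have D1 : 0 < 4 * M * N + 1 by rewrite ltr_wpDl // mulr_ge0 // mulr_ge0 // ltW.
have ev : 0 < e / (3 * (4 * M * N + 1)) by rewrite divr_gt0 // mulr_gt0.
(* [v] is chosen before [z], because [cv] below contains the inverse of [1 - |v|]; only then is
   [rho z] made small against [cv]. *)
have [v vP] : exists v, sn (d v x - db x) <= e / (3 * (4 * M * N + 1)).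
  exact: (@filter_ex _ _ (stolz_nbhs_proper zeta1 M1)) (bk_norm_cvg x M1 ev).
pose L := C * N * (1 + 4 * M).
have M14 : 0 <= 1 + 4 * M by lra.
have L0 : 0 <= L := mulr_ge0 (mulr_ge0 C0 N0) M14.
have v0 : 0 < 1 - cmod (sval v) by rewrite subr_gt0 disc_lt1.
pose cv := (sn (d v x) * N + cnorm x * L) / (1 - cmod (sval v)).
have cv0 : 0 <= cv.
  by apply: divr_ge0; [rewrite addr_ge0 // mulr_ge0 ?seminorm_ge0 ?cnorm_ge0|exact:
    ltW].
have ec : 0 < e / (6 * (cv + 1)) by rewrite divr_gt0 ?mulr_gt0 // ltr_wpDl.
have S0 : stolz_nbhs zeta M (stolz zeta M 0%N) by exists 0%N.
apply: filterS3 (bk_weak_cvg_r y M1 (Kdb x) e3) (stolz_nbhs_close zeta M ec) S0.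
move=> z qz rz Sz w wz; set h := cmod _ in wz *; have h0 : 0 <= h := cmod_ge0 _.
have z0 : 0 < 1 - cmod (sval z) by rewrite subr_gt0 disc_lt1.
have zV0 : 0 <= (1 - cmod (sval z))^-1 by rewrite invr_ge0 ltW.
have N_le := bk_bound C0 dbC y Sz; rewrite -/N in N_le.
have [Kdv Kdiff] := (Kd v x, KB Kip (Kd w y) (Kd z y)).
have Kdb_v := KB Kip (Kdb x) Kdv.
have cw := cmod_one_sub_near wz.
have r0 := cmod_ge0 (sval z - zeta); have rM := ltW (proj2 Sz).
have p1 : cmod (1 - sval w * zeta^*) * cmod (ip (db x - d v x) (d w y - d z y)) <=
  e / 3 * h.
  have k1 := kf_increment y Kdb_v wz; rewrite -/h (seminorm_distC Kip) // in k1.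
  have k2 : cmod (ip (db x - d v x) (d w y - d z y)) <=
      e / (3 * (4 * M * N + 1)) * (2 * h * N / (1 - cmod (sval z))).
    apply: le_trans k1 _; rewrite ler_pM ?seminorm_ge0 //.
      by rewrite !mulr_ge0 ?invr_ge0 ?seminorm_ge0 // ltW.
    by apply: ler_wpM2r => //; apply: ler_wpM2l => //; exact: mulr_ge0.
  apply: le_trans (ler_pM (cmod_ge0 _) (cmod_ge0 _) (le_trans cw (_ : _ <= 2 * (M *
    (1 - cmod (sval z))))) k2) _.
    by rewrite ler_pM2l.
  have -> : 2 * (M * (1 - cmod (sval z))) * (e / (3 * (4 * M * N + 1)) * (2 * h * N
    / (1 - cmod (sval z))))
      = e / 3 * h * ((4 * M * N) / (4 * M * N + 1)).
    by field; rewrite (gt_eqF z0) gt_eqF.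
  rewrite -[leRHS]mulr1; apply: ler_wpM2l; first by rewrite mulr_ge0 // ltW.
  by rewrite ler_pdivrMr // mul1r lerDl.
have p2 : cmod (1 - sval w * zeta^*) * cmod (ip (d v x) (d w y - d z y)) <= e / 3 * h.
  have k1 : cmod (ip (d v x) (d w y - d z y)) <= cv * h.
    have := kf_pointwise_lipschitz v x (bk_adjoint_lipschitz y C0 dbC Sz wz).
    rewrite -/h -/N -/L mulrC -ler_pdivlMr // => k; apply: le_trans k _.
    have vV0 : 0 <= (1 - cmod (sval v))^-1 by rewrite invr_ge0 ltW.
    rewrite /cv mulrAC; apply: ler_wpM2r => //; apply: ler_wpM2r => //; rewrite lerD2r.
    by rewrite ler_wpM2l ?seminorm_ge0.
  apply: le_trans (ler_pM (cmod_ge0 _) (cmod_ge0 _) cw k1) _.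
  have c1 : 0 < cv + 1 by rewrite ltr_wpDl.
  have k3 : 2 * rho z * cv <= e / 3.
    rewrite ltr_pdivlMr ?mulr_gt0 // in rz.
    move=> {M1 M0 C0 N0 e3 D1 ev vP L0 v0 ec qz h0 z0 zV0 N_le rM p1 M14 wz cw k1}.
    by move: (rho z) rz r0 => r; nra.
  by rewrite mulrA ler_wpM2r.
have -> : cdot (W *m x) (T w *m y - T z *m y) - (sval w - sval z) * zeta^* * ip (db
  x) (db y) =
    (sval w - sval z) * zeta^* * (ip (db x) (d z y) - ip (db x) (db y))
    - (1 - sval w * zeta^*) * ip (db x - d v x) (d w y - d z y)
    - (1 - sval w * zeta^*) * ip (d v x) (d w y - d z y).
  rewrite bk_increment (ipBl Kip) //.
  move: (ip _ _) (ip _ _) (ip _ _) (ip _ _) => a1 a2 a3 a4; ring.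
apply: le_trans (cmodB _ _) _; apply: le_trans (lerD (cmodB _ _) (lexx _)) _.
rewrite (cmodM _ (ip (db x - _) _)) (cmodM _ (ip (d v x) _)).
have p3 : cmod ((sval w - sval z) * zeta^* * (ip (db x) (d z y) - ip (db x) (db
  y))) <= e / 3 * h.
  by rewrite !cmodM cmodJ zeta1 mulr1 mulrC ler_wpM2r.
by move=> {M1 M0 C0 N0 e3 D1 ev vP L0 v0 cv0 ec qz rz h0 z0 zV0 N_le rM M14 wz r0
  cw}; lra.
Qed.

End Limits.
End Boundary.

(** * Nontangential limits of matrix functions *)

Section NontangentialLimits.
Variables (R : realType) (zeta : R[i]).
Hypothesis zeta1 : cmod zeta = 1.

Lemma nt_cvg_mx_unique (p q : nat) (f : disc R -> 'M[R[i]]_(p, q)) (l l' :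
  'M[R[i]]_(p, q)) :
  f @ nt_nbhs zeta --> l -> f @ nt_nbhs zeta --> l' -> l = l'.
Proof.
move=> /(nt_cvg_mx zeta) fl /(nt_cvg_mx zeta) fl'; apply/matrixP => i j; apply/eqP.
rewrite -subr_eq0 -cmod_eq0 eq_le cmod_ge0 andbT; apply/ler_addgt0Pr => e e0.
have M1 : 1 < 2 :> R by rewrite ltr1n.
have e20 : 0 < e / 2 by rewrite divr_gt0.
have F := stolz_nbhs_proper zeta1 M1.
have [z [/(_ i j) h1 /(_ i j) h2]] := filter_ex (filterI (fl _ _ M1 e20) (fl' _ _
  M1 e20)).
have -> : l i j - l' i j = (f z i j - l' i j) - (f z i j - l i j) by ring.
by apply: le_trans (cmodB _ _) _; lra.
Qed.

Lemma ntlimE (p q : nat) (f : disc R -> 'M[R[i]]_(p, q)) (l : 'M[R[i]]_(p, q)) :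
  f @ nt_nbhs zeta --> l -> ntlim f zeta = l.
Proof. by move=> fl; exact: nt_cvg_mx_unique (cvgP _ fl) fl. Qed.

Lemma nt_cvg_mx_trans (p q r s : nat) (f : disc R -> 'M[R[i]]_(p, q))
    (g : disc R -> 'M[R[i]]_(r, s)) (l : 'M[R[i]]_(p, q)) (l' : 'M[R[i]]_(r, s)) (c
      : R) :
  (forall z i j, cmod (g z i j - l' i j) <= c * \sum_k \sum_m cmod (f z k m - l k m)) ->
  f @ nt_nbhs zeta --> l -> g @ nt_nbhs zeta --> l'.
Proof.
move=> gf /(nt_cvg_mx zeta) fl; apply/(nt_cvg_mx zeta) => M e M1 e0.
have c1 : 0 < (`|c| + 1) * (p%:R * q%:R + 1).
  by rewrite mulr_gt0 ?ltr_wpDl // mulr_ge0.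
have F := stolz_nbhs_filter zeta M.
apply: filterS (fl M _ M1 (divr_gt0 e0 c1)) => z fz i j; apply: le_trans (gf z i j) _.
set d := e / _ in fz.
have d0 : 0 <= d by rewrite divr_ge0 // ltW.
have S : \sum_k \sum_m cmod (f z k m - l k m) <= p%:R * q%:R * d.
  apply: le_trans (_ : \sum_(k < p) \sum_(m < q) d <= _).
    by apply: ler_sum => k _; apply: ler_sum => m _.
  by rewrite !sumr_const !card_ord -mulrnA -[d *+ _]mulr_natl natrM (mulrC q%:R).
apply: le_trans (_ : `|c| * (p%:R * q%:R * d) <= _).
  apply: le_trans (_ : `|c| * \sum_k \sum_m cmod (f z k m - l k m) <= _).
    rewrite ler_wpM2r ?ler_norm // sumr_ge0 // => k _; rewrite sumr_ge0 // => m _.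
    exact: cmod_ge0.
  by rewrite ler_wpM2l.
have -> : e = (`|c| + 1) * ((p%:R * q%:R + 1) * d) by rewrite mulrA /d mulrC divfK
  // gt_eqF.
have pq0 : 0 <= p%:R * q%:R :> R by rewrite mulr_ge0.
have c0 := normr_ge0 c.
by apply: ler_pM => //; [rewrite mulr_ge0|lra|apply: ler_wpM2r => //; lra].
Qed.

Lemma nt_cvg_mulmxr (p q r : nat) (f : disc R -> 'M[R[i]]_(p, q)) (l : 'M[R[i]]_(p,
  q)) (B : 'M[R[i]]_(q, r)) :
  f @ nt_nbhs zeta --> l -> (fun z => f z *m B) @ nt_nbhs zeta --> l *m B.
Proof.
apply: (@nt_cvg_mx_trans _ _ _ _ _ _ _ _ (\sum_k \sum_m cmod (B k m))) => z i j.
have -> : (f z *m B) i j - (l *m B) i j = \sum_k (f z i k - l i k) * B k j.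
  by rewrite !mxE -sumrB; apply: eq_bigr => k _; rewrite mulrBl.
have B_le k := cmod_entry_le_sum B k j.
apply: le_trans (_ : \sum_k cmod (f z i k - l i k) * (\sum_k \sum_m cmod (B k m)) <= _).
  elim/big_rec2: _ => [|k a b _ IH]; first by rewrite cmod0.
  by apply: le_trans (cmodD _ _) (lerD _ IH); rewrite cmodM ler_wpM2l ?cmod_ge0.
rewrite -mulr_suml mulrC ler_wpM2l //.
  by rewrite sumr_ge0 // => k _; rewrite sumr_ge0 // => m _; exact: cmod_ge0.
rewrite [leRHS](bigD1 i) //= lerDl sumr_ge0 // => k _; rewrite sumr_ge0 // => m _.
exact: cmod_ge0.
Qed.

Variables (n : nat) (Theta : R[i] -> 'M[R[i]]_n) (U : 'M[R[i]]_n).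
Local Notation T z := ((Theta (sval z)) ^t*).

Lemma adjoint_entry (A : 'M[R[i]]_n) i j : (A ^t*) i j = (A j i)^*%R.
Proof. by rewrite !mxE. Qed.

(** Entrywise and operator-norm convergence agree in finite dimension, and the adjoint has the same
    norm; the kernel estimates use the right-hand form. *)
Lemma nt_cvg_adjoint : on_disc Theta @ nt_nbhs zeta --> U <->
  forall M e, 1 < M -> 0 < e -> \forall z \near stolz_nbhs zeta M,
    forall y, cnorm (T z *m y - U ^t* *m y) <= e * cnorm y.
Proof.
have E (z : disc R) i j : cmod (on_disc Theta z i j - U i j) = cmod ((T z - U ^t*) j i).
  have -> : (T z - U ^t*) j i = (on_disc Theta z i j - U i j)^*%R.
    by rewrite rmorphB /= -!adjoint_entry [LHS]mxE [X in _ + X]mxE.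
  by rewrite cmodJ.
split=> [/(nt_cvg_mx zeta) ThU M e M1 e0|H]; last first.
  apply/(nt_cvg_mx zeta) => M e M1 e0; have F := stolz_nbhs_filter zeta M.
  apply: filterS (H M e M1 e0) => z Hz i j; rewrite E -cdot_mx_delta cdot_delta.
  apply: le_trans (cmod_coord_le _ _) _; rewrite mulmxBl.
  by apply: le_trans (Hz _) _; rewrite cnorm_delta mulr1.
have F := stolz_nbhs_filter zeta M.
have n1 : 0 < n%:R ^+ 2 + 1 :> R by rewrite ltr_wpDl ?sqr_ge0.
apply: filterS (ThU M _ M1 (divr_gt0 e0 n1)) => z Hz y; rewrite -mulmxBl.
have Hz' i j : cmod ((T z - U ^t*) i j) <= e / (n%:R ^+ 2 + 1) by rewrite -E.
apply: le_trans (cnorm_mulmx_entries_le _ Hz') _; rewrite ler_wpM2r ?cnorm_ge0 //.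
rewrite mulrCA -[leRHS]mulr1; apply: ler_wpM2l; first exact: ltW.
by rewrite ler_pdivrMr // mul1r lerDl.
Qed.

End NontangentialLimits.

(** * The derivative along a radius *)

Section Derivative.
Variables (R : realType) (n : nat) (Theta : R[i] -> 'M[R[i]]_n).
Hypothesis Theta_analytic : analytic_on_disc Theta.

Lemma deriv_on_disc_entry (z : disc R) (e : R) : 0 < e ->
  exists2 r : R, 0 < r & forall h, h != 0 -> cmod h < r -> forall i j,
    cmod (h^-1 * (Theta (h + sval z) i j - Theta (sval z) i j)
          - deriv_on_disc Theta z i j) <= e.
Proof.
move=> e0; have e0' : 0 < e%:C :> R[i] by rewrite ltcR.
have := @Theta_analytic z; rewrite /derivable => /cvg_ballP/(_ _ e0').
rewrite -/(derive _ _ _) -derive1E.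
move=> [r' /= r'0 r'P]; exists (complex.Re r'); first by rewrite -ltcR -ge0_ReE ?ltW.
move=> h h0 hr i j.
have [|_ /(_ i j)] := r'P h _ h0.
  by rewrite /= sub0r normrN normE (ge0_ReE (ltW r'0)) ltcR.
rewrite /ball /= normE ltcR cmod_distC => /ltW; rewrite !mxE.
by have -> : h%:A = h by rewrite -[RHS]mulr1.
Qed.

Variable zeta : R[i].
Hypothesis zeta1 : cmod zeta = 1.

Lemma radial_lt1 (t : R) : 0 <= t < 1 -> `|t%:C * zeta| < 1.
Proof.
move=> /andP[t0 t1]; rewrite normE cmodM zeta1 mulr1 cmod_real ger0_norm //.
by rewrite -realc1 ltcR.
Qed.

Definition radial (t : R) (t01 : 0 <= t < 1) : disc R :=
  exist (fun z : R[i] => is_true (`|z| < 1)) (t%:C * zeta) (radial_lt1 t01).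

(** The mean value theorem needs a real function of a real variable; [c = 1] and [c = 'i] give the
    real part and, up to sign, the imaginary part of an entry. *)
Lemma is_derive_radial (c : R[i]) (t : R) i j : 0 <= t < 1 ->
  is_derive t 1 (fun t : R => complex.Re (c * Theta (t%:C * zeta) i j))
    (complex.Re (c * (zeta * derive1 Theta (t%:C * zeta) i j))).
Proof.
move=> t01; set f := fun t : R => _; set l := complex.Re _.
suff fl : (h^-1 *: ((f \o shift t) (h *: 1) - f t)) @[h --> 0^'] --> l.
  by apply: DeriveDef; [exact: cvgP fl|exact: cvg_lim fl].
have zeta0 : zeta != 0 by rewrite -cmod_gt0 zeta1.
apply/cvgrPdist_le => e e0; have c1 : 0 < cmod c + 1 by rewrite ltr_wpDl ?cmod_ge0.
have [r r0 rP] := deriv_on_disc_entry (radial t01) (divr_gt0 e0 c1).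
exists r => // h /=; rewrite sub0r normrN => hr h0.
have hC0 : h%:C != 0 :> R[i] by rewrite -cmod_gt0 cmod_real normr_gt0.
have k0 : h%:C * zeta != 0 by rewrite mulf_neq0.
have kr : cmod (h%:C * zeta) < r by rewrite cmodM cmod_real zeta1 mulr1.
have := rP _ k0 kr i j; rewrite /deriv_on_disc /= -mulrDl -realcD.
set D := derive1 Theta _ i j; set a := Theta _ i j;
  set b := Theta (t%:C * zeta) i j => kP.
have -> : l - h^-1 *: ((f \o shift t) (h *: 1) - f t) =
    - complex.Re (c * (zeta * ((h%:C * zeta)^-1 * (a - b) - D))).
  have -> : (f \o shift t) (h *: 1) = complex.Re (c * a).
    by rewrite /f /= [h *: 1]mulr1.
  have -> : c * (zeta * ((h%:C * zeta)^-1 * (a - b) - D)) =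
      (h^-1)%:C * (c * a - c * b) - c * (zeta * D).
    by rewrite realcV; field; rewrite hC0 zeta0.
  rewrite ReD ReN ReZ ReD ReN /l -/D /f -/b opprB; congr (_ - _).
rewrite normrN; apply: le_trans (Re_le_cmod _) _; rewrite !cmodM zeta1 mul1r.
apply: le_trans (_ : (cmod c + 1) * (e / (cmod c + 1)) <= _).
  by apply: ler_pM; rewrite ?cmod_ge0 // lerDl.
by rewrite mulrC divfK // gt_eqF.
Qed.

(** The factor 2 appears because the real and imaginary parts are bounded separately. *)
Lemma radial_increment_le (a b B : R) i j : 0 <= a -> a <= b -> b < 1 ->
  (forall t, a <= t <= b -> cmod (derive1 Theta (t%:C * zeta) i j) <= B) ->
  cmod (Theta (b%:C * zeta) i j - Theta (a%:C * zeta) i j) <= 2 * B * (b - a).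
Proof.
move=> a0 ab b1 DB.
have t01 t : a <= t <= b -> 0 <= t < 1.
  by move=> /andP[at_ tb]; rewrite (le_trans a0 at_) (le_lt_trans tb b1).
have half c : cmod c = 1 ->
    `|complex.Re (c * (Theta (b%:C * zeta) i j - Theta (a%:C * zeta) i j))| <= B *
      (b - a).
  move=> c1; pose f := fun t : R => complex.Re (c * Theta (t%:C * zeta) i j).
  have [|| t] := @MVT_segment R f (fun t => complex.Re (c * (zeta * derive1 Theta
    (t%:C * zeta) i j))) _ _ ab.
  - move=> t; rewrite in_itv /= => /andP[at_ tb]; apply: is_derive_radial; apply: t01.
    by rewrite !ltW.
  - apply: derivable_within_continuous => t; rewrite in_itv /= => tab.
    exact: (@ex_derive _ _ _ _ _ _ _ (is_derive_radial c i j (t01 _ tab))).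
  rewrite in_itv /= => tab fE; rewrite mulrBr ReD ReN -/(f b) -/(f a) fE normrM.
  rewrite (ger0_norm (_ : 0 <= b - a)) ?subr_ge0 // ler_wpM2r ?subr_ge0 //.
  by apply: le_trans (Re_le_cmod _) _; rewrite !cmodM c1 zeta1 !mul1r DB.
apply: le_trans (cmod_le_ReIm _) _.
have h1 := half 1 (cmod1 R); rewrite mul1r in h1.
have := half 'i; rewrite Re_mul_i normrN => h2.
have i1 : cmod ('i : R[i]) = 1 by rewrite /cmod /= expr0n expr1n add0r sqrtr1.
by have := h2 i1; lra.
Qed.

End Derivative.

(** * De Branges-Rovnyak spaces *)

Section BoundaryKernel.
Variables (R : realType) (n : nat) (Theta : R[i] -> 'M[R[i]]_n).
Variables (K : set (disc R -> 'cV[R[i]]_n)).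
Variable ip : (disc R -> 'cV[R[i]]_n) -> (disc R -> 'cV[R[i]]_n) -> R[i].
Hypothesis HK : is_dBR Theta K ip.
Variable zeta : R[i].
Hypothesis zeta1 : cmod zeta = 1.
Local Notation adj := (fun z : disc R => (Theta (sval z)) ^t*).
Local Notation e_ i := (delta_mx i 0 : 'cV[R[i]]_n).
Local Notation sn := (seminorm ip).
Let Kip := dBR_semi_inner HK.

(** [U] is a parameter because the unitary in (3) is not known in advance to be the limit of
    [Theta]. *)
Definition kernel_at (U : 'M[R[i]]_n) (x : 'cV[R[i]]_n) : disc R -> 'cV[R[i]]_n :=
  fun z => dBR_kernel Theta zeta U z *m x.

Lemma dBR_kernel_family : kernel_family K ip adj (delta Theta).
Proof.
split; first exact: dBR_hilbert HK.
- exact: K_delta HK.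
- exact: ip_delta_mul HK.
- exact: delta_total HK.
Qed.

Let Hd := dBR_kernel_family.

Lemma kernel_at_sum U x : kernel_at U x = \sum_i x i 0 *: kernel_at U (e_ i).
Proof.
apply/funext => z; rewrite fct_sumE; exact: mulmx_sum_delta.
Qed.

Lemma delta_sum_coord z x : delta Theta z x = \sum_i x i 0 *: delta Theta z (e_ i).
Proof.
apply/funext => w; rewrite fct_sumE; exact: mulmx_sum_delta.
Qed.

Lemma ip_kernel_at U z x y : K (kernel_at U x) ->
  (1 - sval z * zeta^*) * ip (kernel_at U x) (delta Theta z y) =
  cdot x y - cdot (U ^t* *m x) (adj z *m y).
Proof.
move=> Kx; have -> := ip_delta HK z y Kx.
have -> : cdot (kernel_at U x z) y = _ := cdot_dBR_kernel Theta zeta U z x y.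
by rewrite mulVKf // one_sub_mulCJ_neq0 ?zeta1.
Qed.

Lemma kernel_at_boundary U : U \is unitarymx -> (forall x, K (kernel_at U x)) ->
  boundary_kernel K ip adj (delta Theta) zeta U (kernel_at U).
Proof.
move=> Uu KU; split=> //; first by move=> z x y; exact: ip_kernel_at.
exists (\sum_i sn (kernel_at U (e_ i))).
  by apply: sumr_ge0 => i _; exact: seminorm_ge0.
by move=> x; exact: seminorm_linear_le Kip KU (kernel_at_sum U x).
Qed.

(** By the reproducing property the relation determines every value of [g], so [g] is the kernel
    function itself. *)
Lemma K_kernel_at U x g : K g ->
  (forall w y, (1 - sval w * zeta^*) * ip g (delta Theta w y) =
     cdot x y - cdot (U ^t* *m x) (adj w *m y)) ->
  K (kernel_at U x).
Proof.
move=> Kg gE; suff <- : g = kernel_at U x by [].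
apply/funext => w; apply: cdot_inj => y.
have c0 : 1 - sval w * zeta^* != 0 by rewrite one_sub_mulCJ_neq0 ?zeta1.
apply: (mulfI c0); have <- := ip_delta HK w y Kg.
have -> : cdot (kernel_at U x w) y = _ := cdot_dBR_kernel Theta zeta U w x y.
by rewrite gE mulVKf.
Qed.

(** On [U *m x] the numerator becomes [- (Theta z - U) x], and [1 - z zeta^*] equals
    [- zeta^* (z - zeta)]. *)
Lemma difference_quotient_kernel (U : 'M[R[i]]_n) x : U \is unitarymx ->
  kernel_at U (U *m x) =
  zeta *: (fun z : disc R => (sval z - zeta)^-1 *: ((Theta (sval z) - U) *m x)).
Proof.
move=> Uu; apply/funext => z.
rewrite [RHS](_ : _ = zeta *: ((sval z - zeta)^-1 *: ((Theta (sval z) - U) *m x))) //.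
rewrite /kernel_at /dBR_kernel -scalemxAl scalerA.
have -> : (1%:M - Theta (sval z) *m U ^t*) *m (U *m x) = - ((Theta (sval z) - U) *m x).
  rewrite mulmxBl mul1mx -mulmxA (mulmxA (U ^t*)) unitary_mulCmx // mul1mx.
  by rewrite mulmxBl opprB.
have zeta0 : zeta != 0 by rewrite -cmod_gt0 zeta1.
have zz : zeta * zeta^* = 1 by rewrite mulcJ zeta1 expr1n.
have z0 : sval z - zeta != 0.
  rewrite subr_eq0; apply/eqP => zE; have := disc_lt1 z.
  by rewrite zE zeta1 ltxx.
have c0 : 1 - sval z * zeta^* != 0 by rewrite one_sub_mulCJ_neq0 ?zeta1.
rewrite scalerN -scaleNr; congr (_ *: _).
apply: (mulfI c0); rewrite mulrN mulfV //; apply: (mulIf z0).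
rewrite mulN1r -[RHS]mulrA divfK // mulrBl mul1r -[sval z * _ * _]mulrA.
by rewrite [_^* * _]mulrC zz mulr1 opprB.
Qed.

Lemma K_difference_quotient (U : 'M[R[i]]_n) : U \is unitarymx ->
  (forall x, K (fun z : disc R => (sval z - zeta)^-1 *: ((Theta (sval z) - U) *m
    x))) <->
  (forall x, K (kernel_at U x)).
Proof.
move=> Uu; have zeta0 : zeta != 0 by rewrite -cmod_gt0 zeta1.
split=> KU x.
  have -> : x = U *m (U ^t* *m x) by rewrite mulmxA (unitarymxP Uu) mul1mx.
  by rewrite difference_quotient_kernel //; exact: KZ Kip _ _ (KU _).
have := KZ Kip zeta^-1 (KU (U *m x)).
by rewrite difference_quotient_kernel // scalerA mulVf // scale1r.
Qed.

Section Limits.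
Variable U : 'M[R[i]]_n.
Hypothesis Hb : boundary_kernel K ip adj (delta Theta) zeta U (kernel_at U).
Let KU := bk_K Hb.

Lemma boundary_Theta_cvg : on_disc Theta @ nt_nbhs zeta --> U.
Proof. by apply/(nt_cvg_adjoint zeta) => M e M1 e0; exact: (bk_adjoint_cvg Hd Hb). Qed.

Lemma boundary_ntval : ntval Theta zeta = U.
Proof. exact: ntlimE boundary_Theta_cvg. Qed.

Lemma boundary_function_cvg f : K f ->
  f @ nt_nbhs zeta --> \col_i ip f (kernel_at U (e_ i)).
Proof.
move=> Kf; apply/(nt_cvg_mx zeta) => M e M1 e0.
have FP := stolz_nbhs_proper zeta1 M1.
have : \forall z \near stolz_nbhs zeta M, forall i,
    cmod (ip f (delta Theta z (e_ i)) - ip f (kernel_at U (e_ i))) <= e.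
  by apply: filter_forall => i; exact: (bk_weak_cvg_r Hd Hb).
apply: filterS => z Hz i j; rewrite ord1 mxE -[f z i 0]cdot_delta.
by rewrite -(ip_delta HK).
Qed.

Lemma boundary_ip f x : K f -> ip f (kernel_at U x) = cdot (ntlim f zeta) x.
Proof.
move=> Kf; rewrite (ntlimE zeta1 (boundary_function_cvg Kf)) cdotE kernel_at_sum.
by rewrite (ip_sumr Kip) //; apply: eq_bigr => i _; rewrite mxE mulrC.
Qed.

(** The indices are swapped because [ip] is linear in its first argument. *)
Definition boundary_gram : 'M[R[i]]_n :=
  \matrix_(i, j) ip (kernel_at U (e_ j)) (kernel_at U (e_ i)).

Lemma cdot_boundary_gram x y :
  cdot (boundary_gram *m x) y = ip (kernel_at U x) (kernel_at U y).
Proof.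
rewrite cdotE [X in ip _ X]kernel_at_sum (ip_sumr Kip) //; apply: eq_bigr => i _.
rewrite mulrC; congr (_ * _); rewrite mxE kernel_at_sum (ip_suml Kip) //.
by apply: eq_bigr => j _; rewrite mxE mulrC.
Qed.

Lemma boundary_gram_cvg :
  (1 - `|sval z| ^+ 2)^-1 *: (1%:M - Theta (sval z) *m (Theta (sval z)) ^t*)
    @[z --> nt_nbhs zeta] --> boundary_gram.
Proof.
apply/(nt_cvg_mx zeta) => M e M1 e0; have FP := stolz_nbhs_proper zeta1 M1.
have : \forall z \near stolz_nbhs zeta M, forall i j,
    cmod (ip (delta Theta z (e_ j)) (delta Theta z (e_ i))
     - ip (kernel_at U (e_ j)) (kernel_at U (e_ i))) <= e.
  by apply: filter_forall => i; apply: filter_forall => j; exact: (bk_gram_cvg Hd Hb).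
apply: filterS => z Hz i j; rewrite [boundary_gram i j]mxE.
have := Hz i j.
rewrite [X in cmod (X - _)](ip_delta HK z (e_ i) (K_delta HK z (e_ j))).
by rewrite /delta /= cdot_mx_delta /dBR_kernel -normCK.
Qed.

Lemma boundary_norm_cvg x :
  hnorm ip (delta Theta z x - kernel_at U x) @[z --> nt_nbhs zeta] --> (0 : R).
Proof.
apply/(nt_cvgR zeta) => M e M1 e0; have F := stolz_nbhs_filter zeta M.
apply: filterS (bk_norm_cvg Hd Hb x M1 e0) => z; rewrite subr0 ger0_norm //.
exact: seminorm_ge0.
Qed.

Hypothesis Theta_analytic : analytic_on_disc Theta.

(** [bk_derivative] controls the difference quotients at [z] for all small increments with one
    bound, so a single real increment [t], small depending on [z], transfers it to the
    derivative. *)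
Lemma boundary_derivative_cdot M x y e : 1 < M -> 0 < e ->
  \forall z \near stolz_nbhs zeta M,
    cmod (cdot (deriv_on_disc Theta z *m (U ^t* *m x)) y
      - zeta^* * ip (kernel_at U x) (kernel_at U y)) <= e.
Proof.
move=> M1 e0; have F := stolz_nbhs_filter zeta M; have Uu := bk_unitary Hb.
have e2 : 0 < e / 2 by rewrite divr_gt0.
apply: filterS (bk_derivative Hd Hb x y M1 e2) => z Hz.
have c1 : 0 < n%:R ^+ 2 * cnorm x * cnorm y + 1.
  by rewrite ltr_wpDl // !mulr_ge0 ?cnorm_ge0 ?sqr_ge0.
have [r r0 rP] := deriv_on_disc_entry Theta_analytic z (divr_gt0 e2 c1).
have z1 : 0 < (1 - cmod (sval z)) / 2 by rewrite divr_gt0 // subr_gt0 disc_lt1.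
(* [r / 2] keeps [t] strictly below [r]; the other bound is the range of increments allowed by
   [bk_derivative]. *)
pose t := Num.min (r / 2) ((1 - cmod (sval z)) / 2).
have t0 : 0 < t by rewrite lt_min z1 divr_gt0.
have tr : t < r by apply: le_lt_trans (_ : t <= r / 2) _; rewrite ?ge_min ?lexx //; lra.
have tz : t <= (1 - cmod (sval z)) / 2 by rewrite ge_min lexx orbT.
have h0 : t%:C != 0 :> R[i] by rewrite -cmod_gt0 cmod_real normr_gt0 gt_eqF.
have hE : cmod t%:C = t by rewrite cmod_real ger0_norm // ltW.
have w1 : `|t%:C + sval z| < 1.
  rewrite normE (ltcR _ 1); apply: le_lt_trans (cmodD _ _) _; rewrite hE.
  by move=> {M1 e0 e2 c1 r0 z1 t0 tr}; have := disc_lt1 z; lra.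
pose w : disc R := exist (fun z : R[i] => is_true (`|z| < 1)) _ w1.
have wz : sval w - sval z = t%:C by rewrite /= addrK.
have := Hz w; rewrite wz hE => /(_ tz) {}Hz.
pose D := (t%:C)^-1 *: (Theta (t%:C + sval z) - Theta (sval z)).
have D_le i j : cmod ((D - deriv_on_disc Theta z) i j) <= e / 2 / (n%:R ^+ 2 *
  cnorm x * cnorm y + 1).
  by have := rP _ h0 _ i j; rewrite hE => /(_ tr); rewrite !mxE.
have -> : cdot (deriv_on_disc Theta z *m (U ^t* *m x)) y - zeta^* * ip (kernel_at U
  x) (kernel_at U y) =
   (cdot (D *m (U ^t* *m x)) y - zeta^* * ip (kernel_at U x) (kernel_at U y))
   - cdot ((D - deriv_on_disc Theta z) *m (U ^t* *m x)) y.
  rewrite mulmxBl cdotBl.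
  by move: (cdot _ _) (cdot _ _) (zeta^* * _) => p q s; ring.
rewrite [leRHS]splitr; apply: le_trans (cmodB _ _) _; apply: lerD.
  rewrite -(ler_pM2l t0) -{1}hE -cmodM [t * _]mulrC.
  apply: le_trans Hz; rewrite le_eqVlt; apply/orP; left; apply/eqP; congr cmod.
  rewrite mulrBr mulrA; congr (_ - _).
  rewrite -cdotZl scalemxAl /D scalerA mulfV // scale1r -mulmxBl cdot_mulmx.
  by congr cdot; congr (_ *m _); apply/matrixP => i j; rewrite !mxE rmorphB.
apply: le_trans (cdot_cs _ _) _.
apply: le_trans (ler_wpM2r (cnorm_ge0 _) (cnorm_mulmx_entries_le _ D_le)) _.
rewrite unitary_cnorm //.
set a := n%:R ^+ 2 in c1 *.
have -> : a * (e / 2 / (a * cnorm x * cnorm y + 1)) * cnorm x * cnorm y =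
   e / 2 * (a * cnorm x * cnorm y / (a * cnorm x * cnorm y + 1)).
  by field; rewrite gt_eqF.
rewrite -[leRHS]mulr1; apply: ler_wpM2l; first exact: ltW.
by rewrite ler_pdivrMr // mul1r lerDl.
Qed.

Lemma boundary_derivative_cvg :
  deriv_on_disc Theta @ nt_nbhs zeta --> zeta^* *: (boundary_gram *m U).
Proof.
have Uu := bk_unitary Hb.
apply/(nt_cvg_mx zeta) => M e M1 e0; have FP := stolz_nbhs_proper zeta1 M1.
have : \forall z \near stolz_nbhs zeta M, forall i j,
    cmod (cdot (deriv_on_disc Theta z *m (U ^t* *m (U *m e_ j))) (e_ i)
     - zeta^* * ip (kernel_at U (U *m e_ j)) (kernel_at U (e_ i))) <= e.
  by apply: filter_forall => i; apply: filter_forall => j;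
    exact: boundary_derivative_cdot.
apply: filterS => z Hz i j; have := Hz i j.
rewrite (mulmxA (U ^t*)) unitary_mulCmx // mul1mx cdot_mx_delta -cdot_boundary_gram
  mulmxA.
by rewrite cdot_mx_delta [X in _ -> cmod (_ - X) <= _]mxE.
Qed.

Hypothesis Theta0 : opnorm (Theta 0) < 1.

(** If the form vanishes at [x], so does the kernel function, and its value at 0 gives
    [x = Theta(0) U^* x]. Since [U^*] is isometric, this contradicts [opnorm (Theta 0) < 1] unless
    [x = 0]. *)
Lemma boundary_gram_posdef : posdefmx boundary_gram.
Proof.
move=> x x_neq0; rewrite cdot_boundary_gram lt_def (semi_inner_ip_ge0 Kip) // andbT.
apply/eqP => /(rkhs_ip_eq0 HK (KU x)) kx0.
have d0 : `|0 : R[i]| < 1 by rewrite normr0.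
have := congr1 (fun f => f (exist (fun z : R[i] => is_true (`|z| < 1)) 0 d0)) kx0.
rewrite /kernel_at /dBR_kernel /= mul0r subr0 invr1 scale1r mulmxBl mul1mx => /eqP.
rewrite -[X in _ == X]/(0 : 'cV[R[i]]_n) subr_eq0 -mulmxA => /eqP xE.
have x0 : 0 < cnorm x.
  by rewrite lt_def cnorm_ge0 andbT; apply/eqP => /cnorm0_eq0 /eqP;
    rewrite (negbTE x_neq0).
have := opnormM (Theta 0) (U ^t* *m x); rewrite -xE unitary_cnorm;
  last exact: bk_unitary Hb.
by rewrite -[X in X <= _]mul1r ler_pM2r // leNgt Theta0.
Qed.

Lemma posdef_unitmx (A : 'M[R[i]]_n) : posdefmx A -> A \in unitmx.
Proof.
move=> Apos; rewrite -unitmx_tr -row_free_unit; apply: inj_row_free => v vA.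
apply/eqP; apply: contraT => v0.
have vT0 : v^T != 0 by rewrite -(inj_eq (@trmx_inj _ _ _)) trmxK trmx0.
have := Apos _ vT0; have -> : A *m v^T = 0 by rewrite -[LHS]trmxK trmx_mul trmxK vA
  trmx0.
by rewrite (ip0l (cdot_semi_inner R n)) // ltxx.
Qed.

End Limits.
End BoundaryKernel.

Definition boundary_quotient_norm (R : realType) (n : nat)
    (Theta : R[i] -> 'M[R[i]]_n) (zeta : R[i]) (z : disc R) : R :=
  opnorm ((1 - `|sval z| ^+ 2)^-1 *:
    (1%:M - Theta (sval z) *m (ntval Theta zeta) ^t*)).

(** * The implications between the four conditions *)

Section Implications.
Variables (R : realType) (n : nat) (Theta : R[i] -> 'M[R[i]]_n).
Variables (K : set (disc R -> 'cV[R[i]]_n)).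
Variable ip : (disc R -> 'cV[R[i]]_n) -> (disc R -> 'cV[R[i]]_n) -> R[i].
Hypothesis HK : is_dBR Theta K ip.
Hypothesis Theta_analytic : analytic_on_disc Theta.
Variable zeta : R[i].
Hypothesis zeta1 : cmod zeta = 1.
Local Notation adj := (fun z : disc R => (Theta (sval z)) ^t*).
Local Notation e_ i := (delta_mx i 0 : 'cV[R[i]]_n).
Local Notation sn := (seminorm ip).
Local Notation quotient_norm := (boundary_quotient_norm Theta zeta).
Let Kip := dBR_semi_inner HK.
Let Hd := dBR_kernel_family HK.

Lemma radial_stolz (M t : R) m (t01 : 0 <= t < 1) : 1 < M -> 1 - t < m.+1%:R^-1 ->
  stolz zeta M m (radial zeta1 t01).
Proof.
move=> M1 tm; case/andP: (t01) => t0 t1.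
have E : cmod (t%:C * zeta - zeta) = 1 - t.
  rewrite cmod_distC -[X in X - _]mul1r -mulrBl cmodM zeta1 mulr1 -(realcB 1) cmod_real.
  by rewrite ger0_norm // subr_ge0 ltW.
have zt : cmod (t%:C * zeta) = t by rewrite cmodM zeta1 mulr1 cmod_real ger0_norm.
by split; rewrite /= E // zt ltr_pMl // subr_gt0.
Qed.

Lemma radial_difference_le (D : 'M[R[i]]_n) :
  on_disc Theta @ nt_nbhs zeta --> ntval Theta zeta ->
  deriv_on_disc Theta @ nt_nbhs zeta --> D ->
  exists m (B : R), [/\ 0 <= B & forall (t : R), 0 <= t < 1 -> 1 - t < m.+1%:R^-1 ->
    forall i j, cmod (ntval Theta zeta i j - Theta (t%:C * zeta) i j) <= B * (1 - t)].
Proof.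
move=> /(nt_cvg_mx zeta) ThU /(nt_cvg_mx zeta) ThD;
  have M1 : 1 < 2 :> R by rewrite ltr1n.
have [m _ mD] := ThD 2 1 M1 ltr01.
(* The entries of the derivative lie within 1 of those of [D] in the truncated region. *)
pose B := \sum_i \sum_j cmod (D i j) + 1.
have D_le := cmod_entry_le_sum D.
have B0 : 0 <= B.
  by rewrite addr_ge0 // sumr_ge0 // => k _; rewrite sumr_ge0 // => l _;
    exact: cmod_ge0.
exists m, (2 * B); split=> [|t t01 tm i j]; first by rewrite mulr_ge0.
have DB s : t <= s < 1 -> cmod (derive1 Theta (s%:C * zeta) i j) <= B.
  move=> /andP[ts s1]; have s01 : 0 <= s < 1.
    by rewrite s1 andbT; apply: le_trans ts; case/andP: t01.
  have sm : 1 - s < m.+1%:R^-1 by apply: le_lt_trans tm; lra.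
  have := mD _ (radial_stolz s01 M1 sm) i j; rewrite /deriv_on_disc /= => h.
  have := cmodD (derive1 Theta (s%:C * zeta) i j - D i j) (D i j); rewrite subrK.
  by have := D_le i j; rewrite /B; lra.
apply/ler_addgt0Pr => e e0.
have [k _ kU] := ThU 2 e M1 e0.
case/andP: (t01) => t0 t1.
(* The mean value theorem is applied on the segment from [t] to [s < 1], with [s] so close to 1 that
   [Theta] is within [e] of its boundary value. *)
pose s := Num.max t (1 - k.+2%:R^-1).
have k0 : 0 < k.+2%:R^-1 :> R by rewrite invr_gt0.
have s1 : s < 1 by rewrite gt_max t1 ltrBlDr ltrDl.
have ts : t <= s by rewrite le_max lexx.
have s01 : 0 <= s < 1 by rewrite s1 andbT (le_trans t0).
have sk : 1 - s < k.+1%:R^-1.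
  apply: le_lt_trans (_ : k.+2%:R^-1 < _); last by rewrite ltf_pV2 ?posrE // ltr_nat.
  by rewrite lerBlDr addrC -lerBlDr le_max lexx orbT.
have h1 := kU _ (radial_stolz s01 M1 sk) i j.
have h2 : cmod (Theta (s%:C * zeta) i j - Theta (t%:C * zeta) i j) <= 2 * B * (s - t).
  apply: (radial_increment_le Theta_analytic zeta1) => // u /andP[tu us].
  by apply: DB; rewrite tu (le_lt_trans us).
have -> : ntval Theta zeta i j - Theta (t%:C * zeta) i j =
   (Theta (s%:C * zeta) i j - Theta (t%:C * zeta) i j)
   - (Theta (s%:C * zeta) i j - ntval Theta zeta i j) by ring.
apply: le_trans (cmodB _ _) _; apply: lerD => //.
by apply: le_trans h2 _; rewrite ler_wpM2l ?mulr_ge0 // lerD2r ltW.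
Qed.

(** The limit inferior is the supremum, over the sets [V] of the filter, of the infimum on [V]; one
    radial point in each [V] with quotient at most [c] suffices. There [1 - Theta U^*] equals
    [(U - Theta) U^*], which is of order [1 - t]. *)
Lemma CAD_liminf : has_CAD Theta zeta ->
  (limf_einf (fun z : disc R => (quotient_norm z)%:E) (nt_nbhs zeta) < +oo)%E.
Proof.
move=> [ThU Uu ThD]; set U := ntval Theta zeta in Uu.
have [m [B [B0 UB]]] := radial_difference_le ThU ThD.
pose c := n%:R ^+ 2 * B; have c0 : 0 <= c by rewrite mulr_ge0 ?sqr_ge0.
apply: le_lt_trans (ltry c); rewrite limf_einfE; apply: ge_ereal_sup => _ [V V_nt <-].
have M1 : 1 < 2 :> R by rewrite ltr1n.
have /nt_nbhsP/(_ 2 M1)[k _ kV] := V_nt.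
pose t : R := 1 - (maxn m k).+2%:R^-1.
have p0 : 0 < (maxn m k).+2%:R^-1 :> R by rewrite invr_gt0.
have t01 : 0 <= t < 1.
  by rewrite subr_ge0 invf_le1 // ler1n /= ltrBlDr ltrDl.
have tlt j : (j <= maxn m k)%N -> 1 - t < j.+1%:R^-1.
  by move=> jm; rewrite /t opprB addrC subrK ltf_pV2 ?posrE // ltr_nat ltnS.
have zV := kV _ (radial_stolz t01 M1 (tlt k (leq_maxr _ _))).
apply: le_trans (ereal_inf_lbound _) (_ : (quotient_norm (radial zeta1 t01))%:E <= _)%E.
  by exists (radial zeta1 t01).
rewrite lee_fin; apply: opnorm_le => // x.
case/andP: (t01) => t0 t1.
have zt : cmod (t%:C * zeta) = t by rewrite cmodM zeta1 mulr1 cmod_real ger0_norm.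
have s0 : 0 < 1 - t ^+ 2 by rewrite subr_gt0 exprn_ilt1.
have -> : 1%:M - Theta (sval (radial zeta1 t01)) *m U ^t* = (U - Theta (t%:C *
  zeta)) *m U ^t*.
  by rewrite mulmxBl (unitarymxP Uu).
rewrite -scalemxAl cnormZ -mulmxA /= normE zt -realcX -(realcB 1) -realcV cmod_real.
rewrite ger0_norm ?invr_ge0 ?(ltW s0) // mulrC ler_pdivrMr //.
have UB' i j : cmod ((U - Theta (t%:C * zeta)) i j) <= B * (1 - t).
  by rewrite mxE [X in _ + X]mxE; exact: UB t t01 (tlt m (leq_maxl _ _)) i j.
apply: le_trans (cnorm_mulmx_entries_le _ UB') _.
rewrite unitary_cnorm // /c [leRHS]mulrAC ler_wpM2r ?cnorm_ge0 //.
by rewrite mulrA ler_wpM2l //; nra.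
Qed.

(** Boundedness is asked on nested sets [S] inside the Stolz regions, because (2) controls only some
    points of a region. *)
Lemma bounded_K_kernel_at (U : 'M[R[i]]_n) M (S : nat -> set (disc R)) B x : 1 < M ->
  on_disc Theta @ nt_nbhs zeta --> U ->
  (forall m, S m.+1 `<=` S m) -> (forall m, S m !=set0) ->
  (forall m, S m `<=` stolz zeta M m) ->
  (forall z, S 0%N z -> sn (delta Theta z x) <= B) -> K (kernel_at Theta zeta U x).
Proof.
move=> M1 /(nt_cvg_adjoint zeta) ThU Ssub Sn0 Sstolz SB.
have [|e e0|e e0|g [Kg gE _]] := kf_weak_limit (U := U) (B := B) (y := x) Hd zeta1
  Ssub Sn0 _ _ _.
- exact: SB.
- have [N _ NP] := near_infty_natSinv_lt (PosNum e0).
  by exists N => z /Sstolz[zN _]; exact: ltW (lt_trans zN (NP N (leqnn N))).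
- have x1 : 0 < cnorm x + 1 by rewrite ltr_wpDl ?cnorm_ge0.
  have [m _ Sm] := ThU M _ M1 (divr_gt0 e0 x1); exists m => z /Sstolz/Sm/(_ x) h1.
  by apply: le_trans h1 _; rewrite mulrAC ler_pdivrMr // ler_pM2l // lerDl.
exact: (K_kernel_at HK zeta1 Kg gE).
Qed.

(** Otherwise the set where [c <= f] would contain a truncation of every Stolz region, hence belong
    to the filter, and the limit inferior would be at least [c]. *)
Lemma liminf_frequently (f : disc R -> R) :
  (limf_einf (fun z => (f z)%:E) (nt_nbhs zeta) < +oo)%E ->
  exists M c : R, 1 < M /\ forall m, (stolz zeta M m `&` [set z | f z <= c]) !=set0.
Proof.
move=> f_lt.
have [c fc] : exists c : R, (limf_einf (fun z => (f z)%:E) (nt_nbhs zeta) < c%:E)%E.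
  (* If the limit inferior is [-oo], any real works, and 0 is taken. *)
  move: f_lt; case: limf_einf => [r _| |_] //; last by exists 0; rewrite ltNyr.
  by exists (r + 1); rewrite lte_fin ltrDl.
apply: contrapT => nex; move: fc; rewrite ltNge => /negP; apply.
rewrite limf_einfE.
pose V := [set z | c <= f z].
apply: le_trans (ereal_sup_ubound _); last first.
  exists V; last reflexivity.
  apply/nt_nbhsP => M M1; apply: contrapT => nV; apply: nex; exists M, c; split=> // m.
  apply: contrapT => Sm; apply: nV; exists m => // z Sz; rewrite /V /=.
  by rewrite leNgt; apply/negP => /ltW fz; apply: Sm; exists z.
by apply: le_ereal_inf_tmp => _ [z Vz <-]; rewrite lee_fin.
Qed.

Lemma disc_defect_le (z : disc R) : 1 - cmod (sval z) ^+ 2 <= 2 * cmod (sval z - zeta).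
Proof.
have := cmodD (zeta - sval z) (sval z); rewrite subrK zeta1 cmod_distC => h.
have := disc_lt1 z; have := cmod_ge0 (sval z); have := cmod_ge0 (sval z - zeta).
by move: (cmod (sval z)) (cmod (sval z - zeta)) h => p q; nra.
Qed.

Lemma mulmx_id_eq1 (A : 'M[R[i]]_n) : (forall x : 'cV[R[i]]_n, A *m x = x) -> A = 1%:M.
Proof. by move=> A1; apply/matrixP => i j; rewrite -!cdot_mx_delta A1 mul1mx. Qed.

(** At points where the quotient is at most [c], the vector [x - Theta(z) U^* x] is of order
    [1 - |z|^2]. In the limit this gives [U U^* = 1]; divided by [1 - |z|^2] it bounds the kernel
    functions. *)
Lemma liminf_boundary : has_ntlim (on_disc Theta) zeta ->
  (limf_einf (fun z : disc R => (quotient_norm z)%:E) (nt_nbhs zeta) < +oo)%E ->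
  exists2 U, U \is unitarymx & forall x, K (kernel_at Theta zeta U x).
Proof.
move=> ThU /liminf_frequently[M [c [M1 Sn0]]]; set U := ntval Theta zeta.
pose S m := stolz zeta M m `&` [set z | quotient_norm z <= c].
have sE (z : disc R) : (1 - `|sval z| ^+ 2 : R[i]) = (1 - cmod (sval z) ^+ 2)%:C.
  by rewrite normE -realcX -(realcB 1).
have s_gt0 (z : disc R) : 0 < 1 - cmod (sval z) ^+ 2.
  by apply: lt_le_trans (kf_defect_ge z); rewrite subr_gt0 disc_lt1.
have S_le m z x : S m z ->
    cnorm (x - Theta (sval z) *m (U ^t* *m x)) <= (1 - cmod (sval z) ^+ 2) * (c *
      cnorm x).
  move=> [_ /= zc].
  rewrite -(ler_pdivrMl _ _ (s_gt0 z)).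
  apply: le_trans (ler_wpM2r (cnorm_ge0 x) zc).
  apply: le_trans (opnormM _ _); rewrite -scalemxAl cnormZ mulmxBl mul1mx -mulmxA.
  by rewrite sE -realcV cmod_real ger0_norm // invr_ge0 ltW.
have Uu : U \is unitarymx.
  apply/unitarymxP/mulmx_id_eq1 => x; rewrite -mulmxA; apply/eqP.
  rewrite eq_sym -subr_eq0; apply/eqP/cnorm0_eq0/eqP; rewrite eq_le cnorm_ge0 andbT.
  apply/ler_addgt0Pr => e e0; rewrite add0r; set y := U ^t* *m x.
  pose c1 := 2 * `|c| * cnorm x + n%:R ^+ 2 * cnorm y + 1.
  have c1_gt0 : 0 < c1 by rewrite ltr_wpDl ?addr_ge0 ?mulr_ge0 ?cnorm_ge0 ?sqr_ge0.
  have /(nt_cvg_mx zeta)/(_ M _ M1 (divr_gt0 e0 c1_gt0))[k1 _ S1] := ThU.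
  have [k2 _ S2] := stolz_nbhs_close zeta M (divr_gt0 e0 c1_gt0).
  have [z [Sz zc]] := Sn0 (maxn k1 k2).
  have h1 := S1 z (stolzS (leq_maxl _ _) Sz);
    have h2 := S2 z (stolzS (leq_maxr _ _) Sz).
  set d := e / c1 in h1 h2; have d0 : 0 < d by rewrite divr_gt0.
  have -> : x - U *m y = (x - Theta (sval z) *m y) + (Theta (sval z) - U) *m y.
    by rewrite mulmxBl addrA subrK.
  apply: le_trans (cnormD _ _) _.
  have h1' i j : cmod ((Theta (sval z) - U) i j) <= d.
    by rewrite mxE [X in _ + X]mxE; exact: h1.
  have h3 := cnorm_mulmx_entries_le y h1'.
  have h4 := S_le _ _ x (conj Sz zc); rewrite -/y in h4.
  have h5 : (1 - cmod (sval z) ^+ 2) * (c * cnorm x) <= 2 * d * (`|c| * cnorm x).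
    apply: le_trans (_ : (1 - cmod (sval z) ^+ 2) * (`|c| * cnorm x) <= _).
      by rewrite ler_wpM2l ?(ltW (s_gt0 z)) // ler_wpM2r ?cnorm_ge0 ?ler_norm.
    rewrite ler_wpM2r ?mulr_ge0 ?cnorm_ge0 // (le_trans (disc_defect_le z)) //.
    by rewrite ler_pM2l // ltW.
  have -> : e = d * c1 by rewrite /d divfK // gt_eqF.
  apply: le_trans (lerD (le_trans h4 h5) h3) _.
  have -> : d * c1 = 2 * d * (`|c| * cnorm x) + n%:R ^+ 2 * d * cnorm y + d by
    rewrite /c1; ring.
  by rewrite lerDl ltW.
(* The estimate is [N^2 <= 2 c |x|^2] for the norm [N]; since [N <= 1 + N^2], this [B] avoids a
   square root. *)
exists U => // x; pose B := 1 + 2 * c * cnorm x ^+ 2.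
apply: (bounded_K_kernel_at (S := S) (B := B) M1 ThU) => //.
- by move=> m z [Sz zc]; split=> //; exact: stolzS Sz.
- by move=> m z [].
move=> z Sz; have := kf_seminorm Hd z x; have T_le := kf_contractive Hd z x.
have s0 := s_gt0 z; set s := 1 - _ ^+ 2 in s0 *.
have h1 := S_le _ _ x Sz; rewrite -/s in h1.
(* Splitting [x] through [Theta(z) U^* x] bounds [|x|] times [|x| - |Theta(z)^* x|], and twice this
   product dominates [|x|^2 - |Theta(z)^* x|^2]. *)
have h2 : cnorm x ^+ 2 <= s * (c * cnorm x) * cnorm x + cnorm x * cnorm (adj z *m x).
  have -> : cnorm x ^+ 2 = cmod (cdot x x) by rewrite cnorm_sqr cmod_real ger0_norm
    ?sqr_ge0.
  have -> : cdot x x = cdot (x - Theta (sval z) *m (U ^t* *m x)) x + cdot (U ^t* *m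
    x) (adj z *m x).
    by rewrite -cdot_mulmx -cdotDl subrK.
  apply: le_trans (cmodD _ _) _; apply: lerD.
    by apply: le_trans (cdot_cs _ _) _; rewrite ler_wpM2r ?cnorm_ge0.
  by rewrite -(unitary_cnorm x Uu); apply: le_trans (cdot_cs _ _) _;
    rewrite unitary_cnorm.
have x0 := cnorm_ge0 x; have t0 := cnorm_ge0 (adj z *m x).
rewrite /B; move: (cnorm x) (cnorm (adj z *m x)) x0 t0 T_le h2 => u t u0 t0 tu h2 sN.
have h3 : s * sn (delta Theta z x) ^+ 2 <= s * (2 * c * u ^+ 2) by rewrite sN; nra.
rewrite ler_pM2l // in h3.
by have := seminorm_ge0 ip (delta Theta z x); nra.
Qed.

Lemma ntlim_bounded (f : disc R -> 'cV[R[i]]_n) M x : 1 < M -> has_ntlim f zeta ->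
  exists m, exists B : R, forall z, stolz zeta M m z -> cmod (cdot (f z) x) <= B.
Proof.
move=> M1 /(nt_cvg_mx zeta)/(_ M 1 M1 ltr01)[m _ fm]; set l := lim _ in fm.
exists m, ((\sum_i (cmod (l i 0) + 1)) * cnorm x) => z /fm fz.
apply: le_trans (cdot_cs _ _) _; rewrite ler_wpM2r ?cnorm_ge0 //.
apply: le_trans (cnorm_le_sum _) _; apply: ler_sum => i _.
have := cmodD (f z i 0 - l i 0) (l i 0); rewrite subrK => h.
by apply: le_trans h _; rewrite addrC lerD2l.
Qed.

Lemma all_ntlim_kernel_bounded M : 1 < M -> (forall f, K f -> has_ntlim f zeta) ->
  exists B : R, exists m, forall z, stolz zeta M m z ->
    forall x, sn (delta Theta z x) <= B * cnorm x.
Proof.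
move=> M1 Klim.
have /choice[Bm BmP] : forall i : 'I_n, exists Bm : R * nat, forall z,
    stolz zeta M Bm.2 z -> sn (delta Theta z (e_ i)) <= Bm.1.
  move=> i; have [||f Kf|m [B mB]] := @uniform_boundedness _ _ K ip (dBR_hilbert HK)
      (fun m => [set delta Theta z (e_ i) | z in stolz zeta M m]).
  - by move=> m _ [z _ <-]; exact: K_delta HK _ _.
  - by move=> m _ [z Sz <-]; exists z => //; exact: stolzS Sz.
  - have [m [B fB]] := ntlim_bounded (e_ i) M1 (Klim f Kf).
    exists m, B => _ [z Sz <-].
    rewrite [X in cmod X](ip_delta HK z (e_ i) Kf); exact: fB.
  by exists (B, m) => z Sz; apply: mB; exists z.
exists (\sum_i (Bm i).1), (\max_i (Bm i).2) => z Sz x.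
apply: le_trans (seminorm_linear_le Kip (K_delta HK z) (delta_sum_coord Theta z x)) _.
rewrite ler_wpM2r ?cnorm_ge0 //; apply: ler_sum => i _; apply: BmP.
by apply: stolzS Sz; exact: leq_bigmax.
Qed.

(** If [Theta(z)^* v = 0], then [|v|^2] equals [1 - |z|^2] times the squared norm of delta_z^v,
    hence is at most [2 |z - zeta| B^2 |v|^2]. Once [2 |z - zeta| B^2 < 1], this forces [v = 0]. *)
Lemma all_ntlim_Theta_unit : (forall f, K f -> has_ntlim f zeta) ->
  exists w : disc R, (Theta (sval w)) ^t* \in unitmx.
Proof.
move=> Klim; have M1 : 1 < 2 :> R by rewrite ltr1n.
have [B [m SB]] := all_ntlim_kernel_bounded M1 Klim.
have B1 : 0 < 2 * B ^+ 2 + 1 by rewrite ltr_wpDl // mulr_ge0 // sqr_ge0.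
have B1V : 0 < (2 * B ^+ 2 + 1)^-1 by rewrite invr_gt0.
have [k _ Sk] := stolz_nbhs_close zeta 2 B1V.
have [z Sz] := stolz_nonempty zeta1 (maxn m k) M1.
have {}SB := SB z (stolzS (leq_maxl _ _) Sz).
have zk := Sk z (stolzS (leq_maxr _ _) Sz).
exists z; rewrite -unitmx_tr -row_free_unit; apply: inj_row_free => v vA.
apply/eqP; rewrite -(inj_eq (@trmx_inj _ _ _)) trmx0; apply/eqP/cnorm0_eq0.
have A0 : adj z *m v^T = 0 by rewrite -[LHS]trmxK trmx_mul trmxK vA trmx0.
have := kf_seminorm Hd z v^T; rewrite A0.
have -> : cnorm (0 : 'cV[R[i]]_n) = 0 by rewrite /cnorm (ip0l (cdot_semi_inner R
  n)) // sqrtr0.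
have := disc_defect_le z; have := SB v^T; have := seminorm_ge0 ip (delta Theta z v^T).
have := cnorm_ge0 v^T; rewrite -[_^-1]mul1r ltr_pdivlMr // in zk.
move: (cnorm v^T) (sn _) (cmod (sval z - zeta)) (cmod_ge0 (sval z - zeta)) zk => u
  N r r0 zk u0 N0 NB sr.
set s := 1 - _ ^+ 2 in sr *; rewrite expr0n /= subr0 => sN.
have N2 : N ^+ 2 <= B ^+ 2 * u ^+ 2.
  by rewrite -exprMn ler_pXn2r ?nnegrE // (le_trans N0 NB).
have h : u ^+ 2 <= 2 * r * (B ^+ 2 * u ^+ 2).
  have N20 := sqr_ge0 N; rewrite -[X in X <= _]sN;
    apply: le_trans (_ : 2 * r * N ^+ 2 <= _).
    by rewrite ler_wpM2r.
  by rewrite ler_wpM2l ?mulr_ge0.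
apply/eqP; rewrite -sqrf_eq0 eq_le sqr_ge0 andbT leNgt; apply/negP => u2.
nra.
Qed.

(** The columns of the kernel at [w] belong to [K] and have limits. So [Theta(z) Theta(w)^*], which
    is the identity minus [1 - z w^*] times that kernel, converges, and [Theta(w)^*] is invertible
    for a suitable [w]. *)
Lemma all_ntlim_Theta_cvg : (forall f, K f -> has_ntlim f zeta) ->
  exists U : 'M[R[i]]_n, on_disc Theta @ nt_nbhs zeta --> U.
Proof.
move=> Klim; have [w Tw] := all_ntlim_Theta_unit Klim.
pose l j := ntlim (delta Theta w (e_ j)) zeta.
pose L : 'M[R[i]]_n := \matrix_(i, j)
  ((1%:M : 'M[R[i]]_n) i j - (1 - zeta * (sval w)^*) * l j i 0).
exists (L *m invmx (adj w)).
have -> : on_disc Theta = (fun z => (Theta (sval z) *m adj w) *m invmx (adj w)).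
  by apply/funext => z; rewrite -mulmxA mulmxV // mulmx1.
apply: nt_cvg_mulmxr; apply/(nt_cvg_mx zeta) => M e M1 e0.
have FP := stolz_nbhs_proper zeta1 M1.
(* The limits [l] are multiplied by [z - zeta], and 2 bounds [1 - z w^*] in modulus; the remaining
   unit is slack. *)
pose C := \sum_i \sum_j cmod (l j i 0) + 3.
have l_le := cmod_entry_le_sum (fun i j => l j i 0).
have C0 : 0 < C.
  by rewrite ltr_wpDl // sumr_ge0 // => k _; rewrite sumr_ge0 // => k' _;
    exact: cmod_ge0.
have eC : 0 < e / C by rewrite divr_gt0.
pose d := Num.min 1 (e / C).
have d0 : 0 < d by rewrite lt_min ltr01 eC.
have lim_l : \forall z \near stolz_nbhs zeta M, forall j i k,
    cmod (delta Theta w (e_ j) z i k - l j i k) <= d.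
  apply: filter_forall => j.
  by have /(nt_cvg_mx zeta) := Klim _ (K_delta HK w (e_ j)); apply.
move: lim_l; have := stolz_nbhs_close zeta M d0.
apply: filterS2 => z zd Hz i j.
have z0 : 1 - sval z * (sval w)^* != 0 by rewrite one_sub_mulCJ_neq0 // ltW // disc_lt1.
have g_le := Hz j i 0.
have gE : delta Theta w (e_ j) z i 0 = (1 - sval z * (sval w)^*)^-1 *
    ((1%:M : 'M[R[i]]_n) i j - (Theta (sval z) *m adj w) i j).
  rewrite -cdot_delta /delta cdot_mx_delta /dBR_kernel mxE; congr (_ * _).
  by rewrite [LHS]mxE [X in _ + X]mxE.
set g := delta Theta w (e_ j) z i 0 in g_le gE.
have E : (Theta (sval z) *m adj w) i j - L i j =
   - (1 - sval z * (sval w)^*) * (g - l j i 0) + (sval z - zeta) * (sval w)^* * l j i 0.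
  have -> : (Theta (sval z) *m adj w) i j = (1%:M : 'M[R[i]]_n) i j - (1 - sval z *
    (sval w)^*) * g.
    by rewrite gE mulVKf // opprB addrC subrK.
  by rewrite [L i j]mxE; ring.
rewrite E; apply: le_trans (cmodD _ _) _; rewrite mulNr cmodN !cmodM cmodJ.
have w1 := disc_lt1 w; have z1 := disc_lt1 z.
have c2 : cmod (1 - sval z * (sval w)^*) <= 2.
  apply: le_trans (cmodB _ _) _; rewrite cmod1 cmodM cmodJ.
  move=> {M1 C0 d0 eC e0 g_le}.
  by have := cmod_ge0 (sval w); have := cmod_ge0 (sval z); nra.
have dC : d * C <= e by rewrite -ler_pdivlMr // ge_min lexx orbT.
have h1 : cmod (1 - sval z * (sval w)^*) * cmod (g - l j i 0) <= 2 * d.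
  by apply: ler_pM; rewrite ?cmod_ge0.
have h2 : cmod (sval z - zeta) * cmod (sval w) * cmod (l j i 0) <= d * (C - 3).
  apply: ler_pM; rewrite ?mulr_ge0 ?cmod_ge0 //; last by rewrite /C addrK.
  by rewrite -[leRHS]mulr1; apply: ler_pM; rewrite ?cmod_ge0 // ltW.
by move=> {M1 C0 eC zd g_le w1 z1 c2}; lra.
Qed.

(** With bounded kernels, the kernel relation at [w = z] makes (x, y) minus the inner product of
    [Theta(z)^* x] and [Theta(z)^* y] of order [1 - |z|^2]. Hence [U^*] preserves inner products. *)
Lemma all_ntlim_boundary : (forall f, K f -> has_ntlim f zeta) ->
  exists2 U, U \is unitarymx & forall x, K (kernel_at Theta zeta U x).
Proof.
move=> Klim; have M1 : 1 < 2 :> R by rewrite ltr1n.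
have [U ThU] := all_ntlim_Theta_cvg Klim.
have [B [m SB]] := all_ntlim_kernel_bounded M1 Klim.
exists U; last first.
  (* The kernel bound holds from rank [m] on, hence the shift by [m]. *)
  move=> x; apply: (bounded_K_kernel_at (S := fun k => stolz zeta 2 (m + k)%N) M1
    ThU) => [k|k|k|z].
  - by rewrite addnS; exact: stolzS.
  - exact: stolz_nonempty.
  - exact: stolzS (leq_addl m k).
  - by rewrite addn0 => Sz; exact: SB.
apply/unitarymxP/mulmx_id_eq1 => x.
apply: cdot_inj => y; rewrite -mulmxA cdot_mulmx; apply/eqP;
  rewrite -subr_eq0 -cmod_eq0.
rewrite eq_le cmod_ge0 andbT; apply/ler_addgt0Pr => e e0; rewrite add0r.
have /(nt_cvg_adjoint zeta) ThU' := ThU; set W := U ^t*.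
pose c := cnorm x * cnorm (W *m y) + cnorm x * cnorm y + 2 * (`|B| * cnorm x *
  (`|B| * cnorm y)) + 1.
have c0 : 0 < c by rewrite ltr_wpDl // !addr_ge0 ?mulr_ge0 ?cnorm_ge0.
have [k1 _ S1] := ThU' 2 _ M1 (divr_gt0 e0 c0).
have [k2 _ S2] := stolz_nbhs_close zeta 2 (divr_gt0 e0 c0).
have [z Sz] := stolz_nonempty zeta1 (maxn m (maxn k1 k2)) M1.
have {}SB := SB z (stolzS (leq_maxl _ _) Sz).
have {}Sz := stolzS (leq_maxr _ _) Sz.
have {}S1 := S1 z (stolzS (leq_maxl _ _) Sz);
  have {}S2 := S2 z (stolzS (leq_maxr _ _) Sz).
have d0 := divr_gt0 e0 c0; set d := e / c in d0 S1 S2.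
have -> : cdot (W *m x) (W *m y) - cdot x y =
    - cdot (adj z *m x - W *m x) (W *m y) - cdot (adj z *m x) (adj z *m y - W *m y)
    - (1 - sval z * (sval z)^*) * ip (delta Theta z x) (delta Theta z y).
  rewrite (kf_ip Hd) cdotBl cdotBr.
  by move: (cdot x y) (cdot (W *m x) (W *m y)) (cdot (adj z *m x) (W *m y)) (cdot
    (adj z *m x) (adj z *m y)) => p q r t; ring.
apply: le_trans (cmodB _ _) _; apply: le_trans (lerD (cmodB _ _) (lexx _)) _.
rewrite cmodN mulcJ -(realcB 1) cmodM cmod_real ger0_norm; last first.
  by apply: le_trans (kf_defect_ge z); rewrite subr_ge0 ltW // disc_lt1.
have h1 : cmod (cdot (adj z *m x - W *m x) (W *m y)) <= d * cnorm x * cnorm (W *m y).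
  by apply: le_trans (cdot_cs _ _) _; rewrite ler_wpM2r ?cnorm_ge0.
have h2 : cmod (cdot (adj z *m x) (adj z *m y - W *m y)) <= cnorm x * (d * cnorm y).
  apply: le_trans (cdot_cs _ _) _; apply: ler_pM; rewrite ?cnorm_ge0 //.
  exact: kf_contractive Hd z x.
have SB' u : sn (delta Theta z u) <= `|B| * cnorm u.
  by apply: le_trans (SB u) _; rewrite ler_wpM2r ?cnorm_ge0 ?ler_norm.
have h3 : (1 - cmod (sval z) ^+ 2) * cmod (ip (delta Theta z x) (delta Theta z y)) <=
    2 * d * (`|B| * cnorm x * (`|B| * cnorm y)).
  apply: ler_pM; rewrite ?cmod_ge0 //.
  - by apply: le_trans (kf_defect_ge z); rewrite subr_ge0 ltW // disc_lt1.
  - by apply: le_trans (disc_defect_le z) _; rewrite ler_pM2l // ltW.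
  - apply: le_trans (cauchy_schwarz Kip (K_delta HK z x) (K_delta HK z y)) _.
    by apply: ler_pM; rewrite ?seminorm_ge0.
apply: le_trans (lerD (lerD h1 h2) h3) _.
have -> : e = d * cnorm x * cnorm (W *m y) + cnorm x * (d * cnorm y)
    + 2 * d * (`|B| * cnorm x * (`|B| * cnorm y)) + d.
  have -> : e = d * c by rewrite /d divfK // gt_eqF.
  by rewrite /c; ring.
by rewrite lerDl ltW.
Qed.

End Implications.

Unset Implicit Arguments.

Theorem theorem4p1p1 (R : realType) (n : nat) (Theta : R[i] -> 'M[R[i]]_n)
    (zeta : R[i]) (K : set (disc R -> 'cV[R[i]]_n))
    (ip : (disc R -> 'cV[R[i]]_n) -> (disc R -> 'cV[R[i]]_n) -> R[i])
    (n_gt0 : (0 < n)%N)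
    (Theta_analytic : analytic_on_disc Theta)
    (Theta_contractive : purely_contractive Theta)
    (zeta_circle : `|zeta| = 1)
    (K_dBR : is_dBR Theta K ip) :
  [<-> has_CAD Theta zeta;
       has_ntlim (on_disc Theta) zeta /\
       (limf_einf (fun z : disc R =>
          (opnorm ((1 - `|sval z| ^+ 2)^-1 *:
             (1%:M - Theta (sval z) *m (ntval Theta zeta) ^t*)))%:E)
          (nt_nbhs zeta) < +oo)%E;
       exists2 U : 'M[R[i]]_n, U \is unitarymx & forall x : 'cV[R[i]]_n,
         K (fun z : disc R => (sval z - zeta)^-1 *: ((Theta (sval z) - U) *m x));
       forall f, K f -> has_ntlim f zeta]
  /\ (has_CAD Theta zeta ->
      (forall x : 'cV[R[i]]_n,
         [/\ K (delta_bdry Theta zeta x),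
             forall f, K f ->
               ip f (delta_bdry Theta zeta x) = cdot (ntlim f zeta) x
           & hnorm ip (delta Theta z x - delta_bdry Theta zeta x)
               @[z --> nt_nbhs zeta] --> (0 : R)]) /\
      exists A : 'M[R[i]]_n,
        [/\ posdefmx A,
            ntlim (deriv_on_disc Theta) zeta = zeta^* *: (A *m ntval Theta zeta),
            ntlim (deriv_on_disc Theta) zeta \in unitmx
          & (1 - `|sval z| ^+ 2)^-1 *:
              (1%:M - Theta (sval z) *m (Theta (sval z)) ^t*)
              @[z --> nt_nbhs zeta] --> A]).
Proof.
have zeta1 : cmod zeta = 1 by apply: complexI; rewrite -normE zeta_circle.
have Theta0 := proj2 Theta_contractive.
have CAD_kernel : has_CAD Theta zeta ->
    exists2 U, U \is unitarymx & forall x, K (kernel_at Theta zeta U x).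
  move=> CAD; apply: (liminf_boundary K_dBR zeta1); first by case: CAD.
  exact (CAD_liminf Theta_analytic zeta1 CAD).
split.
  tfae.
  - by move=> CAD; split; [case: CAD|exact (CAD_liminf Theta_analytic zeta1 CAD)].
  - move=> [cvg_Theta liminf_Theta].
    have [U Uu KU] := liminf_boundary K_dBR zeta1 cvg_Theta liminf_Theta.
    by exists U => //; apply/(K_difference_quotient K_dBR zeta1 Uu).
  - move=> [U Uu /(K_difference_quotient K_dBR zeta1 Uu) KU] f Kf.
    have Hb := kernel_at_boundary K_dBR zeta1 Uu KU.
    exact: cvgP (boundary_function_cvg K_dBR zeta1 Hb Kf).
  - move=> /(all_ntlim_boundary K_dBR zeta1)[U Uu KU].
    have Hb := kernel_at_boundary K_dBR zeta1 Uu KU.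
    split; first exact: cvgP (boundary_Theta_cvg K_dBR Hb).
      by rewrite (boundary_ntval K_dBR zeta1 Hb).
    exact: cvgP (boundary_derivative_cvg K_dBR zeta1 Hb Theta_analytic).
move=> /CAD_kernel[U Uu KU]; have Hb := kernel_at_boundary K_dBR zeta1 Uu KU.
(* Identifies the unitary obtained from the implications with the boundary value in the
   statement. *)
have UE := boundary_ntval K_dBR zeta1 Hb.
have Theta'E := ntlimE zeta1 (boundary_derivative_cvg K_dBR zeta1 Hb Theta_analytic).
have A_posdef := boundary_gram_posdef K_dBR Hb Theta0.
split=> [x|].
  have -> : delta_bdry Theta zeta x = kernel_at Theta zeta U x by rewrite
    /delta_bdry UE.
  split=> [|f Kf|]; first exact: KU.
    exact: (boundary_ip K_dBR zeta1 Hb).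
  exact: (boundary_norm_cvg K_dBR Hb).
exists (boundary_gram Theta ip zeta U); split=> //; first by rewrite Theta'E UE.
- rewrite Theta'E unitmxZ ?unitmx_mul ?(posdef_unitmx A_posdef) ?unitarymx_unit //.
  by rewrite unitfE conjC_eq0 -cmod_gt0 zeta1.
- exact: (boundary_gram_cvg K_dBR zeta1 Hb).
Qed.
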